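(* $\mathsf{RCA}_0$ proves: every complete separable metric space which is Heine-Borel compact is Lebesgue.
   Context: Systems. $\mathsf{RCA}_0$ is the theory in the two-sorted language of second order arithmetic (number variables, set variables, $0,1,+,\cdot,=,<,\in$) consisting of the basic arithmetical axioms, induction for $\Sigma^0_1$ formulas and comprehension for $\Delta^0_1$ formulas. Spaces (definitions made in $\mathsf{RCA}_0$; reals are coded by rapidly converging Cauchy sequences of rationals). A (code for a) complete separable metric space $\widehat A$ is a set $A\subseteq\mathbb N$ together with $d:A\times A\to\mathbb R$ such that $d(a,a)=0$, $d(a,b)=d(b,a)\ge 0$, $d(a,b)\le d(a,c)+d(c,b)$ for all $a,b,c\in A$. A point of $\widehat A$ is a sequence $\langle a_n:n\in\mathbb N\rangle$ of elements of $A$ with $d(a_n,a_{n+1})<2^{-n}$ for all $n$; $d$ extends to points in the obvious way and $x,y\in\widehat A$ are identified ($x=y$) when $d(x,y)=0$. $B(x,q)$ denotes the open ball $\{y\in\widehat A: d(x,y)<q\}$. An open set in $\widehat A$ is coded by a sequence $\langle (a_n,q_n):n\in\mathbb N\rangle$ of elements of $A\times\mathbb Q^+$ and means $\bigcup_n B(a_n,q_n)$. An open covering of $\widehat A$ is a sequence $\langle U_n:n\in\mathbb N\rangle$ of open sets such that every $x\in\widehat A$ belongs to some $U_n$. Heine-Borel compact: $\widehat A$ is Heine-Borel compact if every open covering of $\widehat A$ has a finite subcovering. Lebesgue: $\widehat A$ is Lebesgue if for every open covering $\langle U_n:n\in\mathbb N\rangle$ of $\widehat A$ there is $q\in\mathbb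 R^+$ (a Lebesgue number for the covering) such that $\forall x\in\widehat A\,\exists n\ B(x,q)\subseteq U_n$. *)

(* Defs.v *)
(** RCA_0 as a formal theory in two-sorted classical first-order logic, and
    complete separable metric spaces expressed in its language. *)

From Stdlib Require Import List.
Import ListNotations.

(** * The language of second order arithmetic

    De Bruijn indices, with one index space per sort.  The only set terms are
    set variables, so [Fin t X] reads "t is an element of set variable X". *)

Inductive term : Type :=
| tvar (i : nat)
| tzero
| tone
| tadd (t u : term)
| tmul (t u : term).

Inductive form : Type :=
| Fbot
| Feq (t u : term)
| Flt (t u : term)
| Fin (t : term) (X : nat)
| Fimp (p q : form)
| FallN (p : form)
| FallS (p : form).

Definition Fnot (p : form) : form := Fimp p Fbot.
Definition Fand (p q : form) : form := Fnot (Fimp p (Fnot q)).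
Definition For (p q : form) : form := Fimp (Fnot p) q.
Definition Fiff (p q : form) : form := Fand (Fimp p q) (Fimp q p).
Definition FexN (p : form) : form := Fnot (FallN (Fnot p)).
Definition FexS (p : form) : form := Fnot (FallS (Fnot p)).

Definition scons {A : Type} (a : A) (f : nat -> A) (i : nat) : A :=
  match i with 0 => a | S j => f j end.

Fixpoint tsubst (s : nat -> term) (t : term) : term :=
  match t with
  | tvar i => s i
  | tzero => tzero
  | tone => tone
  | tadd t u => tadd (tsubst s t) (tsubst s u)
  | tmul t u => tmul (tsubst s t) (tsubst s u)
  end.

Definition tshift : term -> term := tsubst (fun i => tvar (S i)).

(** Simultaneous substitution of terms for number variables and of set
    variables for set variables. *)
Fixpoint fsubst (s : nat -> term) (r : nat -> nat) (p : form) : form :=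
  match p with
  | Fbot => Fbot
  | Feq t u => Feq (tsubst s t) (tsubst s u)
  | Flt t u => Flt (tsubst s t) (tsubst s u)
  | Fin t X => Fin (tsubst s t) (r X)
  | Fimp p q => Fimp (fsubst s r p) (fsubst s r q)
  | FallN p => FallN (fsubst (scons (tvar 0) (fun i => tshift (s i))) r p)
  | FallS p => FallS (fsubst s (scons 0 (fun i => S (r i))) p)
  end.

Definition shiftN : form -> form := fsubst (fun i => tvar (S i)) (fun X => X).
Definition shiftS : form -> form := fsubst tvar S.
Definition instN (t : term) : form -> form := fsubst (scons t tvar) (fun X => X).
Definition instS (Y : nat) : form -> form := fsubst tvar (scons Y (fun X => X)).

(** * Derivability

    Classical natural deduction.  The eigenvariable condition concerns only
    the local hypotheses [G]; hence a free variable of an axiom may be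
    generalised, i.e. the axioms in [T] stand for their universal closures. *)

Inductive deriv (T : form -> Prop) : list form -> form -> Prop :=
| D_ax G p : T p -> deriv T G p
| D_hyp G p : In p G -> deriv T G p
| D_impI G p q : deriv T (p :: G) q -> deriv T G (Fimp p q)
| D_impE G p q : deriv T G (Fimp p q) -> deriv T G p -> deriv T G q
| D_raa G p : deriv T (Fnot p :: G) Fbot -> deriv T G p
| D_allNI G p : deriv T (map shiftN G) p -> deriv T G (FallN p)
| D_allNE G p t : deriv T G (FallN p) -> deriv T G (instN t p)
| D_allSI G p : deriv T (map shiftS G) p -> deriv T G (FallS p)
| D_allSE G p Y : deriv T G (FallS p) -> deriv T G (instS Y p)
| D_eq_refl G t : deriv T G (Feq t t)
| D_eq_subst G p t u :
    deriv T G (Feq t u) -> deriv T G (instN t p) -> deriv T G (instN u p).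

Definition proves (T : form -> Prop) (p : form) : Prop := deriv T [] p.

(** * The axioms of RCA_0 *)

Inductive bounded : form -> Prop :=
| B_bot : bounded Fbot
| B_eq t u : bounded (Feq t u)
| B_lt t u : bounded (Flt t u)
| B_in t X : bounded (Fin t X)
| B_imp p q : bounded p -> bounded q -> bounded (Fimp p q)
| B_all t p : bounded p -> bounded (FallN (Fimp (Flt (tvar 0) (tshift t)) p))
| B_ex t p : bounded p -> bounded (FexN (Fand (Flt (tvar 0) (tshift t)) p)).

Inductive Sigma01 : form -> Prop :=
| Sigma01_intro p : bounded p -> Sigma01 (FexN p).

Inductive Pi01 : form -> Prop :=
| Pi01_intro p : bounded p -> Pi01 (FallN p).

(** [p(n+1)], where [n] is the number variable 0 of [p]. *)
Definition at_succ : form -> form :=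
  fsubst (scons (tadd (tvar 0) tone) (fun i => tvar (S i))) (fun X => X).

Inductive RCA0 : form -> Prop :=
| A_succ_neq0 :
    RCA0 (Fnot (Feq (tadd (tvar 0) tone) tzero))
| A_succ_inj :
    RCA0 (Fimp (Feq (tadd (tvar 0) tone) (tadd (tvar 1) tone))
               (Feq (tvar 0) (tvar 1)))
| A_add0 :
    RCA0 (Feq (tadd (tvar 0) tzero) (tvar 0))
| A_addS :
    RCA0 (Feq (tadd (tvar 0) (tadd (tvar 1) tone))
              (tadd (tadd (tvar 0) (tvar 1)) tone))
| A_mul0 :
    RCA0 (Feq (tmul (tvar 0) tzero) tzero)
| A_mulS :
    RCA0 (Feq (tmul (tvar 0) (tadd (tvar 1) tone))
              (tadd (tmul (tvar 0) (tvar 1)) (tvar 0)))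
| A_lt0 :
    RCA0 (Fnot (Flt (tvar 0) tzero))
| A_ltS :
    RCA0 (Fiff (Flt (tvar 0) (tadd (tvar 1) tone))
               (For (Flt (tvar 0) (tvar 1)) (Feq (tvar 0) (tvar 1))))
| A_Sigma01_induction p :
    Sigma01 p ->
    RCA0 (Fimp (Fand (instN tzero p) (FallN (Fimp p (at_succ p)))) (FallN p))
| A_Delta01_comprehension p q :
    Sigma01 p -> Pi01 q ->
    RCA0 (Fimp (FallN (Fiff p q))
               (FexS (FallN (Fiff (Fin (tvar 0) 0) (shiftS p))))).

(** * Formulas with named binders

    A formula is represented as a function of the numbers of enclosing number
    and set quantifiers.  The variable bound at depth [d] has index [d' - d - 1]
    when it is used at depth [d'], so expressions can be moved under further
    binders without explicit shifts. *)

Definition nexp : Type := nat -> term.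
Definition sexp : Type := nat -> nat.
Definition fexp : Type := nat -> nat -> form.

Definition sentence (f : fexp) : form := f 0 0.

Definition nzero : nexp := fun _ => tzero.
Definition none : nexp := fun _ => tone.
Definition nadd (x y : nexp) : nexp := fun d => tadd (x d) (y d).
Definition nmul (x y : nexp) : nexp := fun d => tmul (x d) (y d).

Definition eEq (x y : nexp) : fexp := fun d _ => Feq (x d) (y d).
Definition eLt (x y : nexp) : fexp := fun d _ => Flt (x d) (y d).
Definition eIn (x : nexp) (X : sexp) : fexp := fun d e => Fin (x d) (X e).
Definition eNot (f : fexp) : fexp := fun d e => Fnot (f d e).
Definition eImp (f g : fexp) : fexp := fun d e => Fimp (f d e) (g d e).
Definition eAnd (f g : fexp) : fexp := fun d e => Fand (f d e) (g d e).
Definition eOr (f g : fexp) : fexp := fun d e => For (f d e) (g d e).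
Definition eAllN (f : nexp -> fexp) : fexp :=
  fun d e => FallN (f (fun d' => tvar (d' - S d)) (S d) e).
Definition eExN (f : nexp -> fexp) : fexp :=
  fun d e => FexN (f (fun d' => tvar (d' - S d)) (S d) e).
Definition eAllS (f : sexp -> fexp) : fexp :=
  fun d e => FallS (f (fun e' => e' - S e) d (S e)).
Definition eExS (f : sexp -> fexp) : fexp :=
  fun d e => FexS (f (fun e' => e' - S e) d (S e)).

Declare Scope nexp_scope.
Delimit Scope nexp_scope with ne.
Bind Scope nexp_scope with nexp.
Declare Scope fexp_scope.
Delimit Scope fexp_scope with fe.
Bind Scope fexp_scope with fexp.

Notation "0" := nzero : nexp_scope.
Notation "1" := none : nexp_scope.
Notation "2" := (nadd none none) : nexp_scope.
Notation "3" := (nadd (nadd none none) none) : nexp_scope.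
Notation "x + y" := (nadd x y) : nexp_scope.
Notation "x * y" := (nmul x y) : nexp_scope.

Notation "x ≐ y" := (eEq x%ne y%ne) (at level 70, no associativity) : fexp_scope.
Notation "x ≺ y" := (eLt x%ne y%ne) (at level 70, no associativity) : fexp_scope.
Notation "x ∈ X" := (eIn x%ne X) (at level 70, no associativity) : fexp_scope.
Notation "¬ f" := (eNot f) (at level 75, right associativity) : fexp_scope.
Notation "f ∧ g" := (eAnd f g) (at level 80, right associativity) : fexp_scope.
Notation "f ∨ g" := (eOr f g) (at level 85, right associativity) : fexp_scope.
Notation "f ⇒ g" := (eImp f g) (at level 95, right associativity) : fexp_scope.
Notation "'∀¹' x .. y , f" := (eAllN (fun x => .. (eAllN (fun y => f)) ..))
  (at level 200, x binder, y binder, right associativity) : fexp_scope.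
Notation "'∃¹' x .. y , f" := (eExN (fun x => .. (eExN (fun y => f)) ..))
  (at level 200, x binder, y binder, right associativity) : fexp_scope.
Notation "'∀²' X .. Y , f" := (eAllS (fun X => .. (eAllS (fun Y => f)) ..))
  (at level 200, X binder, Y binder, right associativity) : fexp_scope.
Notation "'∃²' X .. Y , f" := (eExS (fun X => .. (eExS (fun Y => f)) ..))
  (at level 200, X binder, Y binder, right associativity) : fexp_scope.

Open Scope fexp_scope.

(** * Pairs, powers of two, rational and real numbers *)

(** The usual pairing map of RCA_0; it is injective, and a term. *)
Definition pair (x y : nexp) : nexp := ((x + y) * (x + y) + x)%ne.

(** [y = 2^k]. *)
Definition isExp2 (E : sexp) : fexp :=
  (∀¹ k, ∃¹ y, pair k y ∈ E) ∧
  (∀¹ k y z, pair k y ∈ E ⇒ pair k z ∈ E ⇒ y ≐ z) ∧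
  pair 0 1 ∈ E ∧
  (∀¹ k y, pair k y ∈ E ⇒ pair (k + 1) (2 * y) ∈ E).

Definition pow2 (k y : nexp) : fexp := ∃² E, isExp2 E ∧ pair k y ∈ E.

(** [Q p n d] is the rational (p - n) / d, where d > 0; its code is the number
    ((p, n), d).  Distinct codes may denote the same rational. *)
Record qexp : Type := Q { qpos : nexp; qneg : nexp; qden : nexp }.

Definition qcode (q : qexp) : nexp := pair (pair (qpos q) (qneg q)) (qden q).

Definition allQ (f : qexp -> fexp) : fexp :=
  ∀¹ p n d, 0 ≺ d ⇒ f (Q p n d).
Definition exQ (f : qexp -> fexp) : fexp :=
  ∃¹ p n d, 0 ≺ d ∧ f (Q p n d).

Notation "'∀ℚ' x .. y , f" := (allQ (fun x => .. (allQ (fun y => f)) ..))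
  (at level 200, x binder, y binder, right associativity) : fexp_scope.
Notation "'∃ℚ' x .. y , f" := (exQ (fun x => .. (exQ (fun y => f)) ..))
  (at level 200, x binder, y binder, right associativity) : fexp_scope.

Definition nle (x y : nexp) : fexp := x ≺ y ∨ x ≐ y.

Definition qsame (q r : qexp) : fexp := qcode q ≐ qcode r.
Definition qle (q r : qexp) : fexp :=
  nle (qpos q * qden r + qneg r * qden q) (qpos r * qden q + qneg q * qden r).
Definition qlt (q r : qexp) : fexp := ¬ qle r q.
Definition qadd (q r : qexp) : qexp :=
  Q (qpos q * qden r + qpos r * qden q)
    (qneg q * qden r + qneg r * qden q)
    (qden q * qden r).
Definition qzero : qexp := Q 0 0 1.

(** A sequence of rationals: [x k q] says that its [k]-th term is [q]. *)
Definition rexp : Type := nexp -> qexp -> fexp.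

(** x is a real: |x_k - x_(k+i)| <= 2^(-k) for all k, i. *)
Definition isReal (x : rexp) : fexp :=
  (∀¹ k, ∃ℚ q, x k q) ∧
  (∀¹ k, ∀ℚ q r, x k q ⇒ x k r ⇒ qsame q r) ∧
  (∀¹ k i y, ∀ℚ q r, x k q ⇒ x (k + i)%ne r ⇒ pow2 k y ⇒
     qle q (qadd r (Q 1 0 y)) ∧ qle r (qadd q (Q 1 0 y))).

(** x <= y iff x_k <= y_k + 2 * 2^(-k) for all k. *)
Definition rle (x y : rexp) : fexp :=
  ∀¹ k z, ∀ℚ q r, x k q ⇒ y k r ⇒ pow2 k z ⇒ qle q (qadd r (Q 2 0 z)).
Definition rlt (x y : rexp) : fexp := ¬ rle y x.
Definition req (x y : rexp) : fexp := rle x y ∧ rle y x.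

(** (x + y)_k = x_(k+1) + y_(k+1). *)
Definition radd (x y : rexp) : rexp := fun k s =>
  ∃ℚ q r, x (k + 1)%ne q ∧ y (k + 1)%ne r ∧ qsame s (qadd q r).

Definition rrat (q : qexp) : rexp := fun _ s => qsame s q.

(** 2^(-n). *)
Definition rpow2inv (n : nexp) : rexp := fun _ s =>
  ∃¹ y, pow2 n y ∧ qsame s (Q 1 0 y).

Definition rset (X : sexp) : rexp := fun k q => pair k (qcode q) ∈ X.

(** * Complete separable metric spaces

    The function d : A * A -> R is coded by the set of all ((a, b), k), q)
    such that q is the k-th term of the real d(a, b). *)

Definition dist (D : sexp) (a b : nexp) : rexp := fun k q =>
  pair (pair (pair a b) k) (qcode q) ∈ D.

Definition isSpace (A D : sexp) : fexp :=
  (∀¹ a b, a ∈ A ⇒ b ∈ A ⇒ isReal (dist D a b)) ∧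
  (∀¹ a, a ∈ A ⇒ req (dist D a a) (rrat qzero)) ∧
  (∀¹ a b, a ∈ A ⇒ b ∈ A ⇒
     req (dist D a b) (dist D b a) ∧ rle (rrat qzero) (dist D a b)) ∧
  (∀¹ a b c, a ∈ A ⇒ b ∈ A ⇒ c ∈ A ⇒
     rle (dist D a b) (radd (dist D a c) (dist D c b))).

(** A sequence of elements of A: [x n a] says that its [n]-th term is [a]. *)
Definition pexp : Type := nexp -> nexp -> fexp.

Definition pset (X : sexp) : pexp := fun n a => pair n a ∈ X.
Definition pconst (a : nexp) : pexp := fun _ b => b ≐ a.

Definition isPoint (A D : sexp) (x : pexp) : fexp :=
  (∀¹ n, ∃¹ a, a ∈ A ∧ x n a) ∧
  (∀¹ n a b, x n a ⇒ x n b ⇒ a ≐ b) ∧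
  (∀¹ n a b, x n a ⇒ x (n + 1)%ne b ⇒ rlt (dist D a b) (rpow2inv n)).

(** d(x, y) is the limit of d(x_n, y_n).  Since the latter moves by at most
    4 * 2^(-n) from n on, the rationals (d(x_(k+3), y_(k+3)))_(k+3) converge
    fast enough to be a real with this limit. *)
Definition pdist (D : sexp) (x y : pexp) : rexp := fun k q =>
  ∃¹ a b, x (k + 3)%ne a ∧ y (k + 3)%ne b ∧ dist D a b (k + 3)%ne q.

(** y is in B(x, r). *)
Definition inBall (D : sexp) (x : pexp) (r : rexp) (y : pexp) : fexp :=
  rlt (pdist D x y) r.

(** A sequence of open sets is coded by the double sequence of the balls
    B(a_(n,k), q_(n,k)) whose union over k is the n-th open set:
    [ballAt U n k a q] says that a = a_(n,k) and q = q_(n,k). *)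
Definition ballAt (U : sexp) (n k a : nexp) (q : qexp) : fexp :=
  pair (pair n k) (pair a (qcode q)) ∈ U.

Definition isOpenSeq (A U : sexp) : fexp :=
  (∀¹ n k, ∃¹ a, ∃ℚ q, ballAt U n k a q) ∧
  (∀¹ n k a b, ∀ℚ q r, ballAt U n k a q ⇒ ballAt U n k b r ⇒
     a ≐ b ∧ qsame q r) ∧
  (∀¹ n k a, ∀ℚ q, ballAt U n k a q ⇒ a ∈ A ∧ qlt qzero q).

(** x belongs to the n-th open set. *)
Definition inOpen (D U : sexp) (n : nexp) (x : pexp) : fexp :=
  ∃¹ k a, ∃ℚ q, ballAt U n k a q ∧ inBall D (pconst a) (rrat q) x.

Definition isOpenCovering (A D U : sexp) : fexp :=
  isOpenSeq A U ∧
  (∀² X, isPoint A D (pset X) ⇒ ∃¹ n, inOpen D U n (pset X)).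

(** F is the (finite) set of indices of the subcovering. *)
Definition hasFiniteSubcovering (A D U : sexp) : fexp :=
  ∃² F, (∃¹ m, ∀¹ n, n ∈ F ⇒ n ≺ m) ∧
    (∀² X, isPoint A D (pset X) ⇒ ∃¹ n, n ∈ F ∧ inOpen D U n (pset X)).

Definition isHeineBorelCompact (A D : sexp) : fexp :=
  ∀² U, isOpenCovering A D U ⇒ hasFiniteSubcovering A D U.

Definition isLebesgueNumber (A D U : sexp) (r : rexp) : fexp :=
  isReal r ∧ rlt (rrat qzero) r ∧
  (∀² X, isPoint A D (pset X) ⇒
     ∃¹ n, ∀² Y, isPoint A D (pset Y) ⇒
       inBall D (pset X) r (pset Y) ⇒ inOpen D U n (pset Y)).

Definition isLebesgue (A D : sexp) : fexp :=
  ∀² U, isOpenCovering A D U ⇒ ∃² R, isLebesgueNumber A D U (rset R).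

(* Main.v *)
(** By the completeness theorem it is enough to argue in an arbitrary, possibly
    nonstandard, model of RCA_0.  Its numbers have an ordered field of fractions,
    in which the rationals of the model and the approximations 2^(-k) live.

    Given an open covering by the sets U_n = union over k of B(a_nk, q_nk), the
    balls B(a_nk, q_nk (j+1)/(j+2)), indexed by (n, k, j), still cover the space.
    Take a finite subcovering of this covering.  If x is in one of its balls and
    d(x, y) < q_nk / (j+2), then y is in B(a_nk, q_nk), hence in U_n.  Only finitely
    many gaps q_nk / (j+2) occur, and Sigma^0_1 induction bounds their denominators
    by some R, so 1/(R+1) is a Lebesgue number.

    The strict order of reals refers to 2^(-k), so the function 2^k has to be shown
    to exist, by coding its finite initial segments.  That d(x_n, x_(n+i)) is at most
    3 * 2^(-n) for a point x is obtained by Sigma^0_1 induction on i from the stronger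
    open condition d(x_n, x_(n+i)) < 3 * 2^(-n) - 2 * 2^(-n-i). *)

Require Import Defs.
From Stdlib Require Import List Lia Arith Cantor.
From Stdlib Require Import FunctionalExtensionality PropExtensionality.
From Stdlib Require Import Classical ClassicalEpsilon.
Import ListNotations.

(** * Substitution *)

(** Passing to models turns derivations into ordinary proofs in which estimates are linear
    arithmetic over a field, but each induction must still be carried by a [Sigma01] formula and
    each set by a [Delta01] one. Hence two recurring devices: all witnesses of a formula are placed
    under a single bound, and auxiliary sets such as the graph of the powers of two become
    parameters.

    The obstacle for the covering is that the slack with which a point lies in a ball depends on the
    point, and no minimum over points is available. Shrinking moves the slack into the index: the
    factors [(j + 1) / (j + 2)] tend to 1, so a point strictly inside a ball is inside one of its
    shrunk copies, and the gap to the original ball is a rational that depends on the index alone.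
    If the shrunk radius is left as an unreduced fraction, the reciprocal of its denominator is a
    lower bound for this gap, so a bound on denominators is a positive lower bound for all gaps at
    once. *)

Definition up (s : nat -> term) : nat -> term :=
  scons (tvar 0) (fun i => tshift (s i)).
Definition upr (r : nat -> nat) : nat -> nat := scons 0 (fun i => S (r i)).

Lemma tsubst_comp (s s' : nat -> term) (t : term) :
  tsubst s' (tsubst s t) = tsubst (fun i => tsubst s' (s i)) t.
Proof. induction t; simpl; congruence. Qed.

Lemma tsubst_id (t : term) : tsubst tvar t = t.
Proof. induction t; simpl; congruence. Qed.

Lemma fsubst_comp (p : form) : forall s r s' r',
  fsubst s' r' (fsubst s r p) =
  fsubst (fun i => tsubst s' (s i)) (fun i => r' (r i)) p.
Proof.
  induction p; intros; simpl; rewrite ?tsubst_comp, ?IHp1, ?IHp2; trivial;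
    f_equal.
  - rewrite IHp; f_equal; extensionality i; destruct i; trivial; simpl.
    unfold tshift; rewrite !tsubst_comp; reflexivity.
  - rewrite IHp; f_equal; extensionality i; destruct i; trivial.
Qed.

Lemma up_tvar : up tvar = tvar.
Proof. extensionality i; destruct i; trivial. Qed.

Lemma upr_id : upr (fun X => X) = fun X => X.
Proof. extensionality i; destruct i; trivial. Qed.

Lemma fsubst_id (p : form) : fsubst tvar (fun X => X) p = p.
Proof.
  induction p; simpl; rewrite ?tsubst_id; try congruence.
  - change (FallN (fsubst (up tvar) (fun X => X) p) = FallN p).
    rewrite up_tvar; congruence.
  - change (FallS (fsubst tvar (upr (fun X => X)) p) = FallS p).
    rewrite upr_id; congruence.
Qed.

Fixpoint tbound (t : term) : nat :=
  match t with
  | tvar i => S i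
  | tzero | tone => 0
  | tadd t u | tmul t u => max (tbound t) (tbound u)
  end.

Fixpoint nbound (p : form) : nat :=
  match p with
  | Fbot => 0
  | Feq t u | Flt t u => max (tbound t) (tbound u)
  | Fin t _ => tbound t
  | Fimp p q => max (nbound p) (nbound q)
  | FallN p => pred (nbound p)
  | FallS p => nbound p
  end.

Fixpoint sbound (p : form) : nat :=
  match p with
  | Fbot | Feq _ _ | Flt _ _ => 0
  | Fin _ X => S X
  | Fimp p q => max (sbound p) (sbound q)
  | FallN p => sbound p
  | FallS p => pred (sbound p)
  end.

Lemma tsubst_ext (s s' : nat -> term) (t : term) :
  (forall i, i < tbound t -> s i = s' i) -> tsubst s t = tsubst s' t.
Proof.
  induction t; simpl; intros H; trivial; try (apply H; lia);
    rewrite IHt1, IHt2; trivial; intros; apply H; lia.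
Qed.

Lemma fsubst_ext (p : form) : forall s s' r r',
  (forall i, i < nbound p -> s i = s' i) ->
  (forall i, i < sbound p -> r i = r' i) ->
  fsubst s r p = fsubst s' r' p.
Proof.
  induction p; simpl; intros s s' r r' H H'; trivial.
  - f_equal; apply tsubst_ext; intros; apply H; lia.
  - f_equal; apply tsubst_ext; intros; apply H; lia.
  - f_equal; [apply tsubst_ext; intros; apply H; lia | apply H'; lia].
  - f_equal; [apply IHp1 | apply IHp2]; intros; (apply H || apply H'); lia.
  - f_equal; apply IHp; trivial.
    intros [|i] Hi; trivial; simpl; f_equal; apply H; lia.
  - f_equal; apply IHp; trivial.
    intros [|i] Hi; trivial; simpl; f_equal; apply H'; lia.
Qed.

(** * Admissible rules *)

Section Derivations.

Variable T : form -> Prop.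

Lemma deriv_weaken G p : deriv T G p -> forall G', incl G G' -> deriv T G' p.
Proof.
  induction 1; intros G' HG.
  - now apply D_ax.
  - apply D_hyp; auto.
  - apply D_impI, IHderiv; firstorder.
  - eapply D_impE; eauto.
  - apply D_raa, IHderiv; firstorder.
  - apply D_allNI, IHderiv; now apply incl_map.
  - apply D_allNE; auto.
  - apply D_allSI, IHderiv; now apply incl_map.
  - apply D_allSE; auto.
  - apply D_eq_refl.
  - eapply D_eq_subst; eauto.
Qed.

Lemma shiftN_fsubst s r p :
  shiftN (fsubst s r p) = fsubst (up s) r (shiftN p).
Proof. unfold shiftN; now rewrite !fsubst_comp. Qed.

Lemma shiftS_fsubst s r p :
  shiftS (fsubst s r p) = fsubst s (upr r) (shiftS p).
Proof.
  unfold shiftS; rewrite !fsubst_comp; simpl; f_equal.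
  extensionality i; apply tsubst_id.
Qed.

Lemma instN_fsubst s r t p :
  fsubst s r (instN t p) = instN (tsubst s t) (fsubst (up s) r p).
Proof.
  unfold instN; rewrite !fsubst_comp; f_equal.
  extensionality i; destruct i; trivial; simpl.
  unfold tshift; rewrite tsubst_comp; simpl; symmetry; apply tsubst_id.
Qed.

Lemma instS_fsubst s r Y p :
  fsubst s r (instS Y p) = instS (r Y) (fsubst s (upr r) p).
Proof.
  unfold instS; rewrite !fsubst_comp; f_equal.
  - extensionality i; simpl; symmetry; apply tsubst_id.
  - extensionality i; destruct i; trivial.
Qed.

Definition subst_closed : Prop :=
  forall p s r, T p -> deriv T [] (fsubst s r p).

(** All logical rules commute with substitution. Axioms are the only other source of formulas, and
    [subst_closed] is discharged for every [T] by [subst_closedP]. *)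
Lemma deriv_subst G p : subst_closed -> deriv T G p ->
  forall s r, deriv T (map (fsubst s r) G) (fsubst s r p).
Proof.
  intros HT; induction 1; intros s r.
  - apply deriv_weaken with []; [now apply HT | firstorder].
  - apply D_hyp; now apply in_map.
  - simpl; apply D_impI, IHderiv.
  - eapply D_impE; [apply IHderiv1 | apply IHderiv2].
  - apply D_raa, IHderiv.
  - simpl; apply D_allNI.
    specialize (IHderiv (up s) r).
    rewrite map_map in IHderiv |- *; erewrite map_ext; [exact IHderiv|].
    intros; apply shiftN_fsubst.
  - rewrite instN_fsubst; apply D_allNE, IHderiv.
  - simpl; apply D_allSI.
    specialize (IHderiv s (upr r)).
    rewrite map_map in IHderiv |- *; erewrite map_ext; [exact IHderiv|].
    intros; apply shiftS_fsubst.
  - rewrite instS_fsubst; apply D_allSE, IHderiv.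
  - apply D_eq_refl.
  - rewrite instN_fsubst; eapply D_eq_subst; [apply IHderiv1|].
    rewrite <- instN_fsubst; apply IHderiv2.
Qed.

Lemma D_eq_sym G t u : deriv T G (Feq t u) -> deriv T G (Feq u t).
Proof.
  intros H.
  pose proof (D_eq_subst T G (Feq (tvar 0) (tshift t)) t u H) as E.
  unfold instN, tshift in E; simpl in E; rewrite !tsubst_comp in E; simpl in E.
  rewrite tsubst_id in E; apply E, D_eq_refl.
Qed.

Lemma D_eq_trans G t u v :
  deriv T G (Feq t u) -> deriv T G (Feq u v) -> deriv T G (Feq t v).
Proof.
  intros H1 H2.
  pose proof (D_eq_subst T G (Feq (tshift t) (tvar 0)) u v H2) as E.
  unfold instN, tshift in E; simpl in E; rewrite !tsubst_comp in E; simpl in E.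
  rewrite tsubst_id in E; auto.
Qed.

(** Nested universal closures are instantiated from the outermost variable
    inwards, so that no instantiated term is substituted into again. *)
Lemma iter_allN_inst (n : nat) : forall p s,
  deriv T [] (Nat.iter n FallN p) ->
  deriv T [] (fsubst (fun i => if i <? n then s i else tvar (i - n))
                     (fun X => X) p).
Proof.
  assert (Hi : forall n s p, fsubst s (fun X => X) (Nat.iter n FallN p) =
    Nat.iter n FallN (fsubst (Nat.iter n up s) (fun X => X) p)).
  { clear; induction n as [|n IH]; intros; trivial.
    change (fsubst s (fun X => X) (FallN (Nat.iter n FallN p)) =
       FallN (Nat.iter n FallN (fsubst (Nat.iter (S n) up s) (fun X => X) p))).
    simpl fsubst; f_equal; fold (up s); rewrite IH.
    now rewrite <- (Nat.iter_succ_r n _ up). }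
  assert (Hu : forall n t i, Nat.iter n up (scons t tvar) i =
     if i <? n then tvar i else if i =? n then
       tsubst (fun i => tvar (i + n)) t else tvar (pred i)).
  { clear; induction n as [|n IH]; intros t i.
    - destruct i; simpl; trivial.
      replace (fun i : nat => tvar (i + 0)) with tvar;
        [now rewrite tsubst_id | extensionality i; f_equal; lia].
    - destruct i; trivial; simpl; rewrite IH.
      change (S i <? S n) with (i <? n).
      destruct (Nat.ltb_spec i n); trivial.
      destruct (Nat.eqb_spec i n).
      + unfold tshift; rewrite tsubst_comp; simpl; f_equal.
        extensionality j; f_equal; lia.
      + unfold tshift; simpl; f_equal; destruct i; simpl; lia. }
  induction n as [|n IH]; intros p s H.
  - simpl in H.
    replace (fun i => if i <? 0 then s i else tvar (i - 0)) with tvar;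
      [now rewrite fsubst_id|].
    extensionality i; simpl; f_equal; lia.
  - change (deriv T [] (FallN (Nat.iter n FallN p))) in H.
    apply (D_allNE T _ _ (s n)) in H.
    unfold instN in H; rewrite Hi in H.
    apply (IH _ s) in H; rewrite fsubst_comp in H.
    match goal with |- deriv _ _ ?a => match type of H with deriv _ _ ?b =>
      replace a with b; trivial end end.
    f_equal; extensionality i; rewrite Hu.
    destruct (Nat.ltb_spec i n).
    + simpl.
      destruct (Nat.ltb_spec i n); [|lia].
      destruct (Nat.ltb_spec i (S n)); [trivial|lia].
    + destruct (Nat.eqb_spec i n).
      * subst i; rewrite tsubst_comp; simpl.
        destruct (Nat.ltb_spec n (S n)); [|lia].
        rewrite <- tsubst_id; f_equal; extensionality j.
        destruct (Nat.ltb_spec (j + n) n); [lia|f_equal; lia].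
      * simpl.
        destruct (Nat.ltb_spec (pred i) n); [lia|].
        destruct (Nat.ltb_spec i (S n)); [lia|].
        f_equal; lia.
Qed.

Lemma iter_allS_inst (n : nat) : forall p r,
  deriv T [] (Nat.iter n FallS p) ->
  deriv T [] (fsubst tvar (fun i => if i <? n then r i else i - n) p).
Proof.
  assert (Hi : forall n r p, fsubst tvar r (Nat.iter n FallS p) =
    Nat.iter n FallS (fsubst tvar (Nat.iter n upr r) p)).
  { clear; induction n as [|n IH]; intros; trivial.
    change (fsubst tvar r (FallS (Nat.iter n FallS p)) =
       FallS (Nat.iter n FallS (fsubst tvar (Nat.iter (S n) upr r) p))).
    simpl fsubst; f_equal; fold (upr r); rewrite IH.
    now rewrite <- (Nat.iter_succ_r n _ upr). }
  assert (Hu : forall n Y i, Nat.iter n upr (scons Y (fun X => X)) i =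
     if i <? n then i else if i =? n then Y + n else pred i).
  { clear; induction n as [|n IH]; intros t i.
    - destruct i; simpl; trivial; lia.
    - destruct i; trivial; simpl; rewrite IH.
      change (S i <? S n) with (i <? n).
      destruct (Nat.ltb_spec i n); trivial.
      destruct (Nat.eqb_spec i n); lia. }
  induction n as [|n IH]; intros p r H.
  - simpl in H.
    replace (fun i => if i <? 0 then r i else i - 0) with (fun i : nat => i);
      [now rewrite fsubst_id|].
    extensionality i; simpl; lia.
  - change (deriv T [] (FallS (Nat.iter n FallS p))) in H.
    apply (D_allSE T _ _ (r n)) in H.
    unfold instS in H; rewrite Hi in H.
    apply (IH _ r) in H; rewrite fsubst_comp in H.
    match goal with |- deriv _ _ ?a => match type of H with deriv _ _ ?b =>
      replace a with b; trivial end end.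
    f_equal; extensionality i; rewrite Hu.
    destruct (Nat.ltb_spec i n).
    + destruct (Nat.ltb_spec i n); [|lia].
      destruct (Nat.ltb_spec i (S n)); [trivial|lia].
    + destruct (Nat.eqb_spec i n).
      * subst i.
        destruct (Nat.ltb_spec n (S n)); [|lia].
        destruct (Nat.ltb_spec (r n + n) n); lia.
      * destruct (Nat.ltb_spec (pred i) n); [lia|].
        destruct (Nat.ltb_spec i (S n)); lia.
Qed.

(** Under no local hypotheses every free variable of an axiom may be generalised. The axiom is
    closed up to its bound and instantiated again, with the set variables treated before the number
    variables. *)
Lemma subst_closedP : subst_closed.
Proof.
  intros p s r Hp.
  assert (H : deriv T [] (fsubst tvar r p)).
  { rewrite (fsubst_ext p _ tvar _
      (fun i => if i <? sbound p then r i else i - sbound p)); trivial.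
    - apply iter_allS_inst.
      assert (H : deriv T [] p) by now apply D_ax.
      induction (sbound p); trivial; now apply D_allSI.
    - intros i Hi; destruct (Nat.ltb_spec i (sbound p)); lia. }
  replace (fsubst s r p) with (fsubst s (fun X => X) (fsubst tvar r p))
    by (rewrite fsubst_comp; reflexivity).
  set (q := fsubst tvar r p) in *.
  rewrite (fsubst_ext q _
    (fun i => if i <? nbound q then s i else tvar (i - nbound q)) _ 
    (fun X => X)); trivial.
  - apply iter_allN_inst.
    induction (nbound q); trivial; now apply D_allNI.
  - intros i Hi; destruct (Nat.ltb_spec i (nbound q)); trivial; lia.
Qed.

(** The renaming that sends [x] to 0 and raises every other index turns the instance into the
    premise of [D_allNI]. It agrees with [shiftN] on [G] because [x] does not occur there. *)
Lemma D_allN_fresh G p x : 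
  (forall q, In q G -> nbound q <= x) -> nbound (FallN p) <= x ->
  deriv T G (instN (tvar x) p) -> deriv T G (FallN p).
Proof.
  intros HG Hp H; apply D_allNI.
  apply (deriv_subst _ _ subst_closedP) with
    (s := fun i => if i =? x then tvar 0 else tvar (S i)) (r := fun X => X) in H.
  unfold instN in H; rewrite fsubst_comp in H; simpl in Hp.
  rewrite <- (fsubst_id p).
  rewrite (fsubst_ext p _ (fun i => tsubst
    (fun i => if i =? x then tvar 0 else tvar (S i)) (scons (tvar x) tvar i))
    _ (fun X => X)); trivial.
  - erewrite map_ext_in; [exact H|].
    intros q Hq; apply fsubst_ext; trivial.
    intros i Hi; specialize (HG q Hq); destruct (Nat.eqb_spec i x); trivial; lia.
  - intros [|i] Hi; simpl; [now rewrite Nat.eqb_refl|].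
    destruct (Nat.eqb_spec i x); trivial; lia.
Qed.

Lemma D_allS_fresh G p x : 
  (forall q, In q G -> sbound q <= x) -> sbound (FallS p) <= x ->
  deriv T G (instS x p) -> deriv T G (FallS p).
Proof.
  intros HG Hp H; apply D_allSI.
  apply (deriv_subst _ _ subst_closedP) with
    (s := tvar) (r := fun i => if i =? x then 0 else S i) in H.
  unfold instS in H; rewrite fsubst_comp in H; simpl in Hp.
  rewrite <- (fsubst_id p).
  rewrite (fsubst_ext p _ (fun i => tsubst tvar (tvar i)) _
   (fun i => if scons x (fun X => X) i =? x then 0 else S (scons x (fun X => X) i)));
   trivial.
  - erewrite map_ext_in; [exact H|].
    intros q Hq; apply fsubst_ext; trivial.
    intros i Hi; specialize (HG q Hq); destruct (Nat.eqb_spec i x); trivial; lia.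
  - intros [|i] Hi; simpl; [now rewrite Nat.eqb_refl|].
    destruct (Nat.eqb_spec i x); trivial; lia.
Qed.

End Derivations.

(** * Completeness *)

(** Henkin structures: the sets are an arbitrary second sort with a membership relation, so that
    first-order completeness applies. Equality is not a field, since it is interpreted by
    identity. *)
Record model := Model {
  num : Type;
  nset : Type;
  mzero : num;
  mone : num;
  madd : num -> num -> num;
  mmul : num -> num -> num;
  mlt : num -> num -> Prop;
  mmem : num -> nset -> Prop
}.

Fixpoint teval (M : model) (s : nat -> num M) (t : term) : num M :=
  match t with
  | tvar i => s i
  | tzero => mzero M
  | tone => mone M
  | tadd t u => madd M (teval M s t) (teval M s u)
  | tmul t u => mmul M (teval M s t) (teval M s u)
  end.

Fixpoint sat (M : model) (s : nat -> num M) (r : nat -> nset M) (p : form) :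
    Prop :=
  match p with
  | Fbot => False
  | Feq t u => teval M s t = teval M s u
  | Flt t u => mlt M (teval M s t) (teval M s u)
  | Fin t X => mmem M (teval M s t) (r X)
  | Fimp p q => sat M s r p -> sat M s r q
  | FallN p => forall x, sat M (scons x s) r p
  | FallS p => forall X, sat M s (scons X r) p
  end.

Definition models (M : model) (T : form -> Prop) : Prop :=
  forall p s r, T p -> sat M s r p.

Fixpoint term_code (t : term) : nat :=
  match t with
  | tvar i => to_nat (0, i)
  | tzero => to_nat (1, 0)
  | tone => to_nat (2, 0)
  | tadd t u => to_nat (3, to_nat (term_code t, term_code u))
  | tmul t u => to_nat (4, to_nat (term_code t, term_code u))
  end.

Fixpoint form_code (p : form) : nat :=
  match p with
  | Fbot => to_nat (0, 0)
  | Feq t u => to_nat (1, to_nat (term_code t, term_code u))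
  | Flt t u => to_nat (2, to_nat (term_code t, term_code u))
  | Fin t X => to_nat (3, to_nat (term_code t, X))
  | Fimp p q => to_nat (4, to_nat (form_code p, form_code q))
  | FallN p => to_nat (5, form_code p)
  | FallS p => to_nat (6, form_code p)
  end.

Lemma to_nat_inj' a b c d : to_nat (a, b) = to_nat (c, d) -> a = c /\ b = d.
Proof. intros H; apply to_nat_inj in H; now injection H. Qed.

Ltac code_inj :=
  repeat match goal with
  | H : to_nat (_, _) = to_nat (_, _) |- _ =>
      apply to_nat_inj' in H; destruct H
  end.

Lemma term_code_inj t : forall u, term_code t = term_code u -> t = u.
Proof.
  induction t; destruct u; cbn [term_code]; intros H; code_inj; try discriminate;
    f_equal; auto.
Qed.

Lemma form_code_inj p : forall q, form_code p = form_code q -> p = q.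
Proof.
  induction p; destruct q; cbn [form_code]; intros H; code_inj; try discriminate;
    f_equal; auto using term_code_inj.
Qed.

(** * The Henkin construction *)

Section Henkin.

Variables (T : form -> Prop) (p0 : form).
Hypothesis unprovable : ~ deriv T [] p0.

Definition consistent (G : list form) : Prop := ~ deriv T G Fbot.

(** A number that codes no formula decodes to an arbitrary one. This is harmless, as a stage of the
    chain may treat any formula. *)
Definition form_decode (n : nat) : form :=
  epsilon (inhabits Fbot) (fun p => form_code p = n).

Lemma form_decode_code p : form_decode (form_code p) = p.
Proof.
  apply form_code_inj; unfold form_decode.
  apply (epsilon_spec (inhabits Fbot) (fun q => form_code q = form_code p)).
  now exists p.
Qed.

Definition fresh (f : form -> nat) (G : list form) : nat :=
  fold_right (fun p n => max (f p) n) 0 G.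

Lemma fresh_spec f G p : In p G -> f p <= fresh f G.
Proof.
  induction G; simpl; [easy|].
  intros [->|H]; [lia|specialize (IHG H); lia].
Qed.

Definition witness (G : list form) (p : form) : form :=
  match p with
  | FallN q => instN (tvar (fresh nbound (p :: G))) q
  | FallS q => instS (fresh sbound (p :: G)) q
  | _ => p
  end.

Definition extend (G : list form) (p : form) : list form :=
  if excluded_middle_informative (consistent (p :: G)) then p :: G
  else Fnot (witness G p) :: Fnot p :: G.

Fixpoint chain (n : nat) : list form :=
  match n with
  | 0 => [Fnot p0]
  | S n => extend (chain n) (form_decode n)
  end.

Lemma witness_sound G p : deriv T G (witness G p) -> deriv T G p.
Proof.
  destruct p; simpl; trivial; intros H.
  - eapply D_allN_fresh; [..|exact H].
    + intros q Hq; apply (fresh_spec nbound) in Hq; lia.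
    + apply Nat.le_max_l.
  - eapply D_allS_fresh; [..|exact H].
    + intros q Hq; apply (fresh_spec sbound) in Hq; lia.
    + apply Nat.le_max_l.
Qed.

(** If [p] cannot be added, [G] derives [Fnot p]. If the negated witness were inconsistent as well,
    [G] would derive the witness, hence [p] by freshness of its variable. *)
Lemma extend_consistent G p : consistent G -> consistent (extend G p).
Proof.
  intros HG; unfold extend.
  destruct (excluded_middle_informative _) as [H|H]; trivial.
  intros H2; apply NNPP in H; apply HG.
  assert (Hn : deriv T G (Fnot p)) by now apply D_impI.
  apply D_raa in H2.
  eapply D_impE; [exact Hn|]; apply witness_sound.
  eapply D_impE; [apply D_impI; exact H2|exact Hn].
Qed.

Lemma chain_consistent n : consistent (chain n).
Proof.
  induction n; simpl.
  - intros H; apply unprovable; now apply D_raa.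
  - now apply extend_consistent.
Qed.

Lemma chain_mono n m : n <= m -> incl (chain n) (chain m).
Proof.
  induction 1; [apply incl_refl|].
  intros p Hp; apply IHle in Hp; simpl; unfold extend.
  destruct (excluded_middle_informative _); simpl; auto.
Qed.

Definition theory (p : form) : Prop := exists n, In p (chain n).

Lemma theory_bound G : (forall p, In p G -> theory p) ->
  exists n, incl G (chain n).
Proof.
  induction G as [|p G IH]; intros H.
  - exists 0; intros p [].
  - destruct IH as [n Hn]; [intros; apply H; now right|].
    destruct (H p) as [m Hm]; [now left|].
    exists (max n m); apply incl_cons.
    + revert Hm; apply chain_mono; lia.
    + eapply incl_tran; [exact Hn|]; apply chain_mono; lia.
Qed.

Lemma theory_consistent G : (forall p, In p G -> theory p) -> consistent G.
Proof.
  intros H Hd; destruct (theory_bound G H) as [n Hn].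
  eapply (chain_consistent n), deriv_weaken; eauto.
Qed.

Lemma theory_step p : theory p \/ 
  exists G, theory (Fnot p) /\ theory (Fnot (witness G p)).
Proof.
  pose (n := form_code p).
  assert (H : chain (S n) = extend (chain n) p)
    by (simpl; unfold n; now rewrite form_decode_code).
  revert H; unfold extend; destruct (excluded_middle_informative _); intros H.
  - left; exists (S n); rewrite H; now left.
  - right; exists (chain n); split; exists (S n); rewrite H; simpl; auto.
Qed.

Lemma theory_deriv G p :
  (forall q, In q G -> theory q) -> deriv T G p -> theory p.
Proof.
  intros HG Hd; destruct (theory_step p) as [H|[_ [H _]]]; trivial.
  exfalso; apply (theory_consistent (Fnot p :: G)).
  - intros q [<-|Hq]; auto.
  - apply D_impE with p; [apply D_hyp; now left|].
    eapply deriv_weaken; [exact Hd|]; intros q; now right.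
Qed.

Lemma theory_mp p q : theory (Fimp p q) -> theory p -> theory q.
Proof.
  intros H1 H2; apply (theory_deriv [Fimp p q; p]).
  - intros r [<-|[<-|[]]]; trivial.
  - eapply D_impE; apply D_hyp; simpl; eauto.
Qed.

Lemma theory_bot : ~ theory Fbot.
Proof.
  intros H; apply (theory_consistent [Fbot]).
  - now intros q [<-|[]].
  - apply D_hyp; now left.
Qed.

Lemma theory_imp p q : theory (Fimp p q) <-> (theory p -> theory q).
Proof.
  split; [apply theory_mp|intros H].
  destruct (theory_step p) as [Hp|[_ [Hp _]]].
  - apply (theory_deriv [q]); [intros r [<-|[]]; auto|].
    apply D_impI, D_hyp; simpl; auto.
  - apply (theory_deriv [Fnot p]); [intros r [<-|[]]; auto|].
    apply D_impI, D_raa, D_impE with p; apply D_hyp; simpl; auto.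
Qed.

Lemma theory_allN p : theory (FallN p) <-> forall t, theory (instN t p).
Proof.
  split; intros H.
  - intros t; apply (theory_deriv [FallN p]); [intros r [<-|[]]; auto|].
    apply D_allNE, D_hyp; now left.
  - destruct (theory_step (FallN p)) as [Hp|[G [_ Hp]]]; trivial.
    exfalso; apply theory_bot; eapply theory_mp; [exact Hp|]; apply H.
Qed.

Lemma theory_allS p : theory (FallS p) <-> forall Y, theory (instS Y p).
Proof.
  split; intros H.
  - intros t; apply (theory_deriv [FallS p]); [intros r [<-|[]]; auto|].
    apply D_allSE, D_hyp; now left.
  - destruct (theory_step (FallS p)) as [Hp|[G [_ Hp]]]; trivial.
    exfalso; apply theory_bot; eapply theory_mp; [exact Hp|]; apply H.
Qed.

Lemma theory_eq_refl t : theory (Feq t t).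
Proof. apply (theory_deriv []); [easy|]; apply D_eq_refl. Qed.

Lemma theory_eq_sym t u : theory (Feq t u) -> theory (Feq u t).
Proof.
  intros H; apply (theory_deriv [Feq t u]); [now intros q [<-|[]]|].
  apply D_eq_sym, D_hyp; now left.
Qed.

Lemma theory_eq_trans t u v :
  theory (Feq t u) -> theory (Feq u v) -> theory (Feq t v).
Proof.
  intros H1 H2; apply (theory_deriv [Feq t u; Feq u v]).
  - now intros q [<-|[<-|[]]].
  - apply D_eq_trans with u; apply D_hyp; simpl; auto.
Qed.

Lemma theory_eq_subst p t u :
  theory (Feq t u) -> theory (instN t p) -> theory (instN u p).
Proof.
  intros H1 H2; apply (theory_deriv [Feq t u; instN t p]).
  - now intros q [<-|[<-|[]]].
  - apply D_eq_subst with t; apply D_hyp; simpl; auto.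
Qed.

(** The numbers of the term model are the canonical representatives of the
    classes of provably equal terms. *)
Definition rep (t : term) : term :=
  epsilon (inhabits t) (fun u => theory (Feq t u)).

Lemma rep_eq t : theory (Feq t (rep t)).
Proof.
  apply (epsilon_spec (inhabits t) (fun u => theory (Feq t u))).
  exists t; apply theory_eq_refl.
Qed.

Lemma rep_complete t u : theory (Feq t u) -> rep t = rep u.
Proof.
  intros H; unfold rep.
  replace (fun v => theory (Feq t v)) with (fun v => theory (Feq u v)).
  - f_equal; apply proof_irrelevance.
  - extensionality v; apply propositional_extensionality.
    split; intros H'; eapply theory_eq_trans; eauto using theory_eq_sym.
Qed.

Definition tnum : Type := {t : term | rep t = t}.

Lemma rep_rep t : rep (rep t) = rep t.
Proof. symmetry; apply rep_complete, rep_eq. Qed.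

Definition cls (t : term) : tnum := exist _ (rep t) (rep_rep t).

Lemma cls_eq t u : cls t = cls u <-> theory (Feq t u).
Proof.
  split; intros H.
  - injection H as H; apply theory_eq_trans with (rep t); [apply rep_eq|].
    rewrite H; apply theory_eq_sym, rep_eq.
  - apply eq_sig_hprop; [intros; apply proof_irrelevance|].
    now apply rep_complete.
Qed.

Lemma cls_proj (x : tnum) : cls (proj1_sig x) = x.
Proof.
  apply eq_sig_hprop; [intros; apply proof_irrelevance|].
  exact (proj2_sig x).
Qed.

Definition term_model : model := {|
  num := tnum;
  nset := nat;
  mzero := cls tzero;
  mone := cls tone;
  madd x y := cls (tadd (proj1_sig x) (proj1_sig y));
  mmul x y := cls (tmul (proj1_sig x) (proj1_sig y));
  mlt x y := theory (Flt (proj1_sig x) (proj1_sig y));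
  mmem x X := theory (Fin (proj1_sig x) X)
|}.

(** Variables 0 and 1 of [p] mark two positions; the equality rule, which replaces one term at a
    time, is applied to each in turn. *)
Lemma theory_congr p s t t' u u' :
  theory (Feq t t') -> theory (Feq u u') ->
  theory (fsubst (scons t (scons u s)) (fun X => X) p) ->
  theory (fsubst (scons t' (scons u' s)) (fun X => X) p).
Proof.
  assert (H1 : forall t u, fsubst (scons t (scons u s)) (fun X => X) p =
    instN t (fsubst (scons (tvar 0) (scons (tshift u) (fun i => tshift (s i))))
       (fun X => X) p)).
  { intros; unfold instN; rewrite fsubst_comp; f_equal.
    extensionality i; destruct i as [|[|i]]; trivial; simpl;
      unfold tshift; rewrite tsubst_comp; symmetry; apply tsubst_id. }
  assert (H2 : forall t u, fsubst (scons t (scons u s)) (fun X => X) p =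
    instN u (fsubst (scons (tshift t) (scons (tvar 0) (fun i => tshift (s i))))
       (fun X => X) p)).
  { intros; unfold instN; rewrite fsubst_comp; f_equal.
    extensionality i; destruct i as [|[|i]]; trivial; simpl;
      unfold tshift; rewrite tsubst_comp; symmetry; apply tsubst_id. }
  intros Ht Hu; rewrite H1; intros H.
  apply (theory_eq_subst _ _ _ Ht) in H; revert H.
  rewrite <- H1, H2, (H2 t' u'); now apply theory_eq_subst.
Qed.

Lemma teval_cls s t : teval term_model (fun i => cls (s i)) t = cls (tsubst s t).
Proof.
  induction t; simpl; trivial; rewrite IHt1, IHt2; apply cls_eq; simpl.
  - apply (theory_congr (Feq (tadd (tvar 0) (tvar 1)) (tadd (tvar 2) (tvar 3)))
      (scons (tsubst s t1) (scons (tsubst s t2) tvar)) (tsubst s t1) _ (tsubst s t2));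
      simpl; auto using rep_eq, theory_eq_refl.
  - apply (theory_congr (Feq (tmul (tvar 0) (tvar 1)) (tmul (tvar 2) (tvar 3)))
      (scons (tsubst s t1) (scons (tsubst s t2) tvar)) (tsubst s t1) _ (tsubst s t2));
      simpl; auto using rep_eq, theory_eq_refl.
Qed.

(** The quantifier cases succeed because every number of the model is the class of a term and every
    set is a variable. *)
Lemma truth p : forall s r,
  sat term_model (fun i => cls (s i)) r p <-> theory (fsubst s r p).
Proof.
  induction p; intros s r; simpl.
  - split; [easy|apply theory_bot].
  - rewrite !teval_cls; apply cls_eq.
  - rewrite !teval_cls; simpl; split;
      apply (theory_congr (Flt (tvar 0) (tvar 1)) tvar);
      auto using rep_eq, theory_eq_sym.
  - rewrite !teval_cls; simpl; split;
      apply (theory_congr (Fin (tvar 0) (r X)) tvar _ _ tzero tzero);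
      auto using rep_eq, theory_eq_sym, theory_eq_refl.
  - now rewrite IHp1, IHp2, theory_imp.
  - rewrite theory_allN.
    assert (H : forall t, sat term_model (scons (cls t) (fun i => cls (s i))) r p
      <-> theory (instN t (fsubst (up s) r p))).
    { intros t; unfold instN; rewrite fsubst_comp.
      replace (fun i => tsubst (scons t tvar) (up s i)) with (scons t s).
      - rewrite <- IHp; replace (fun i => cls (scons t s i))
          with (scons (cls t) (fun i => cls (s i))); [tauto|].
        extensionality i; now destruct i.
      - extensionality i; destruct i; trivial; simpl; unfold tshift.
        rewrite tsubst_comp; symmetry; apply tsubst_id. }
    split; intros H' x; [now apply H|].
    rewrite <- (cls_proj x); now apply H.
  - rewrite theory_allS.
    assert (H : forall Y, sat term_model (fun i => cls (s i)) (scons Y r) p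
      <-> theory (instS Y (fsubst s (upr r) p))).
    { intros t; unfold instS; rewrite fsubst_comp, IHp.
      match goal with |- theory ?a <-> theory ?b => replace b with a; [tauto|] end.
      f_equal; extensionality i; [symmetry; apply tsubst_id | now destruct i]. }
    now split; intros H' x; apply H.
Qed.

Lemma term_model_models : models term_model T.
Proof.
  intros p s r Hp.
  replace s with (fun i => cls (proj1_sig (s i)))
    by (extensionality i; apply cls_proj).
  apply truth, (theory_deriv []); [easy|]; now apply subst_closedP.
Qed.

Lemma term_model_refutes : exists s r, ~ sat term_model s r p0.
Proof.
  exists (fun i => cls (tvar i)), (fun X => X).
  rewrite truth, fsubst_id; intros H.
  apply (theory_consistent [Fnot p0; p0]).
  - intros q [<-|[<-|[]]]; trivial; exists 0; now left.
  - apply D_impE with p0; apply D_hyp; simpl; auto.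
Qed.

End Henkin.

Theorem completeness (T : form -> Prop) (p : form) :
  (forall M, models M T -> forall s r, sat M s r p) -> deriv T [] p.
Proof.
  intros H; apply NNPP; intros Hp.
  destruct (term_model_refutes T p Hp) as (s & r & Hn).
  apply Hn, H, term_model_models; trivial.
Qed.

(** * The statement in a model *)

Definition is_bot (p : form) : bool :=
  match p with Fbot => true | _ => false end.

(** The language has no primitive conjunction or existential
    quantifier.  [nsat true] is [sat] and [nsat false] its negation, with
    negations pushed inwards so that the encoded conjunctions and existential
    quantifiers compute to the native ones. *)
Fixpoint nsat (M : model) (b : bool) (s : nat -> num M) (r : nat -> nset M)
    (p : form) : Prop :=
  match p with
  | Fbot => if b then False else True
  | Feq t u => if b then teval M s t = teval M s u else teval M s t <> teval M s u
  | Flt t u =>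
      if b then mlt M (teval M s t) (teval M s u)
      else ~ mlt M (teval M s t) (teval M s u)
  | Fin t X => if b then mmem M (teval M s t) (r X) else ~ mmem M (teval M s t) (r X)
  | Fimp p q =>
      if is_bot q then nsat M (negb b) s r p
      else if b then nsat M true s r p -> nsat M true s r q
      else nsat M true s r p /\ nsat M false s r q
  | FallN p =>
      if b then forall x, nsat M true (scons x s) r p
      else exists x, nsat M false (scons x s) r p
  | FallS p =>
      if b then forall X, nsat M true s (scons X r) p
      else exists X, nsat M false s (scons X r) p
  end.

Lemma nsat_sat M p : forall b s r,
  nsat M b s r p <-> if b then sat M s r p else ~ sat M s r p.
Proof.
  induction p as [|t u|t u|t X|p IHp q IHq|p IH|p IH]; intros b s r.
  1-4: destruct b; simpl; tauto.
  - cbn [nsat sat]; destruct (is_bot q) eqn:Eq.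
    + destruct q; try discriminate; rewrite IHp; destruct b; simpl; tauto.
    + pose proof (IHp true s r); pose proof (IHq true s r).
      pose proof (IHp false s r); pose proof (IHq false s r); cbn beta iota in *.
      destruct b; tauto.
  - destruct b; cbn [nsat sat].
    + split; intros H x; apply (IH true), H.
    + split.
      * intros [x Hx] H; apply (IH false) in Hx; apply Hx, H.
      * intros H; apply not_all_ex_not in H as [x Hx].
        exists x; now apply (IH false).
  - destruct b; cbn [nsat sat].
    + split; intros H x; apply (IH true), H.
    + split.
      * intros [x Hx] H; apply (IH false) in Hx; apply Hx, H.
      * intros H; apply not_all_ex_not in H as [x Hx].
        exists x; now apply (IH false).
Qed.

Section Semantics.

Variable M : model.

Local Notation N := (num M).
Local Notation "x + y" := (madd M x y).
Local Notation "x * y" := (mmul M x y).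
Local Notation "0" := (mzero M).
Local Notation "1" := (mone M).
Local Notation "2" := (1 + 1).
Local Notation "3" := (1 + 1 + 1).

Definition mpair (x y : N) : N := (x + y) * (x + y) + x.

Definition mIsExp2 (E : nset M) : Prop :=
  (forall k, exists y, mmem M (mpair k y) E) /\
  (forall k y z, mmem M (mpair k y) E -> mmem M (mpair k z) E -> y = z) /\
  mmem M (mpair 0 1) E /\
  (forall k y, mmem M (mpair k y) E -> mmem M (mpair (k + 1) (2 * y)) E).

Definition mpow2 (k y : N) : Prop := exists E, mIsExp2 E /\ mmem M (mpair k y) E.

Record mrat : Type := MQ { mpos : N; mneg : N; mden : N }.

Definition mcode (q : mrat) : N := mpair (mpair (mpos q) (mneg q)) (mden q).

Definition mallQ (f : mrat -> Prop) : Prop :=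
  forall p n d, mlt M 0 d -> f (MQ p n d).
Definition mexQ (f : mrat -> Prop) : Prop :=
  exists p n d, mlt M 0 d /\ f (MQ p n d).

Definition mnle (x y : N) : Prop := ~ mlt M x y -> x = y.

Definition mqsame (q r : mrat) : Prop := mcode q = mcode r.
Definition mqle (q r : mrat) : Prop :=
  mnle (mpos q * mden r + mneg r * mden q) (mpos r * mden q + mneg q * mden r).
Definition mqlt (q r : mrat) : Prop :=
  ~ mlt M (mpos r * mden q + mneg q * mden r) (mpos q * mden r + mneg r * mden q) /\
  mpos r * mden q + mneg q * mden r <> mpos q * mden r + mneg r * mden q.
Definition mqadd (q r : mrat) : mrat :=
  MQ (mpos q * mden r + mpos r * mden q)
     (mneg q * mden r + mneg r * mden q)
     (mden q * mden r).
Definition mqzero : mrat := MQ 0 0 1.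

Definition mreal : Type := N -> mrat -> Prop.

Definition mIsReal (x : mreal) : Prop :=
  (forall k, mexQ (x k)) /\
  (forall k, mallQ (fun q => mallQ (fun r => x k q -> x k r -> mqsame q r))) /\
  (forall k i y, mallQ (fun q => mallQ (fun r =>
     x k q -> x (k + i) r -> mpow2 k y ->
     mqle q (mqadd r (MQ 1 0 y)) /\ mqle r (mqadd q (MQ 1 0 y))))).

Definition mrle (x y : mreal) : Prop :=
  forall k z, mallQ (fun q => mallQ (fun r =>
    x k q -> y k r -> mpow2 k z -> mqle q (mqadd r (MQ 2 0 z)))).
(** The negation of [mrle y x], in the form computed by [nsat]. *)
Definition mrlt (x y : mreal) : Prop :=
  exists k z, mexQ (fun q => mexQ (fun r =>
    y k q /\ x k r /\ mpow2 k z /\ mqlt (mqadd r (MQ 2 0 z)) q)).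
Definition mreq (x y : mreal) : Prop := mrle x y /\ mrle y x.

Definition mradd (x y : mreal) : mreal := fun k s =>
  mexQ (fun q => mexQ (fun r => x (k + 1) q /\ y (k + 1) r /\ mqsame s (mqadd q r))).

Definition mrrat (q : mrat) : mreal := fun _ s => mqsame s q.

Definition mrpow2inv (n : N) : mreal := fun _ s =>
  exists y, mpow2 n y /\ mqsame s (MQ 1 0 y).

Definition mrset (X : nset M) : mreal := fun k q => mmem M (mpair k (mcode q)) X.

Definition mdist (D : nset M) (a b : N) : mreal := fun k q =>
  mmem M (mpair (mpair (mpair a b) k) (mcode q)) D.

Definition mIsSpace (A D : nset M) : Prop :=
  (forall a b, mmem M a A -> mmem M b A -> mIsReal (mdist D a b)) /\
  (forall a, mmem M a A -> mreq (mdist D a a) (mrrat mqzero)) /\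
  (forall a b, mmem M a A -> mmem M b A ->
     mreq (mdist D a b) (mdist D b a) /\ mrle (mrrat mqzero) (mdist D a b)) /\
  (forall a b c, mmem M a A -> mmem M b A -> mmem M c A ->
     mrle (mdist D a b) (mradd (mdist D a c) (mdist D c b))).

Definition mpoint : Type := N -> N -> Prop.

Definition mpset (X : nset M) : mpoint := fun n a => mmem M (mpair n a) X.
Definition mpconst (a : N) : mpoint := fun _ b => b = a.

Definition mIsPoint (A D : nset M) (x : mpoint) : Prop :=
  (forall n, exists a, mmem M a A /\ x n a) /\
  (forall n a b, x n a -> x n b -> a = b) /\
  (forall n a b, x n a -> x (n + 1) b -> mrlt (mdist D a b) (mrpow2inv n)).

Definition mpdist (D : nset M) (x y : mpoint) : mreal := fun k q =>
  exists a b, x (k + 3) a /\ y (k + 3) b /\ mdist D a b (k + 3) q.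

Definition mInBall (D : nset M) (x : mpoint) (r : mreal) (y : mpoint) : Prop :=
  mrlt (mpdist D x y) r.

Definition mballAt (U : nset M) (n k a : N) (q : mrat) : Prop :=
  mmem M (mpair (mpair n k) (mpair a (mcode q))) U.

Definition mIsOpenSeq (A U : nset M) : Prop :=
  (forall n k, exists a, mexQ (mballAt U n k a)) /\
  (forall n k a b, mallQ (fun q => mallQ (fun r =>
     mballAt U n k a q -> mballAt U n k b r -> a = b /\ mqsame q r))) /\
  (forall n k a, mallQ (fun q =>
     mballAt U n k a q -> mmem M a A /\ mqlt mqzero q)).

Definition mInOpen (D U : nset M) (n : N) (x : mpoint) : Prop :=
  exists k a, mexQ (fun q => mballAt U n k a q /\ mInBall D (mpconst a) (mrrat q) x).

Definition mIsOpenCovering (A D U : nset M) : Prop :=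
  mIsOpenSeq A U /\
  (forall X, mIsPoint A D (mpset X) -> exists n, mInOpen D U n (mpset X)).

Definition mHasFiniteSubcovering (A D U : nset M) : Prop :=
  exists F : nset M, (exists m, forall n, mmem M n F -> mlt M n m) /\
    (forall X, mIsPoint A D (mpset X) -> exists n, mmem M n F /\ mInOpen D U n (mpset X)).

Definition mIsHeineBorelCompact (A D : nset M) : Prop :=
  forall U, mIsOpenCovering A D U -> mHasFiniteSubcovering A D U.

Definition mIsLebesgueNumber (A D U : nset M) (r : mreal) : Prop :=
  mIsReal r /\ mrlt (mrrat mqzero) r /\
  (forall X, mIsPoint A D (mpset X) ->
     exists n, forall Y, mIsPoint A D (mpset Y) ->
       mInBall D (mpset X) r (mpset Y) -> mInOpen D U n (mpset Y)).

Definition mIsLebesgue (A D : nset M) : Prop :=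
  forall U, mIsOpenCovering A D U -> exists R, mIsLebesgueNumber A D U (mrset R).

End Semantics.

(** Both sides are convertible. This dictates the shape of the definitions above, such as the
    implication in [mnle] and the two conjuncts of [mqlt]. *)
Lemma nsat_lebesgue (M : model) s r :
  nsat M true s r (sentence (∀² A D,
    isSpace A D ⇒ isHeineBorelCompact A D ⇒ isLebesgue A D)) =
  forall A D, mIsSpace M A D -> mIsHeineBorelCompact M A D -> mIsLebesgue M A D.
Proof. reflexivity. Qed.

(** * Induction and comprehension in a model *)

Lemma teval_subst M s (t : term) (s' : nat -> term) :
  teval M s (tsubst s' t) = teval M (fun i => teval M s (s' i)) t.
Proof. induction t; simpl; congruence. Qed.

Lemma sat_subst M p : forall s r s' r',
  sat M s r (fsubst s' r' p) <->
  sat M (fun i => teval M s (s' i)) (fun i => r (r' i)) p.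
Proof.
  induction p; intros s r s' r'; simpl; rewrite ?teval_subst; try tauto.
  - now rewrite IHp1, IHp2.
  - assert (H : forall x, sat M (scons x s) r (fsubst (up s') r' p) <->
      sat M (scons x (fun i => teval M s (s' i))) (fun i => r (r' i)) p).
    { intros x; rewrite IHp; match goal with |- sat _ ?a _ _ <-> sat _ ?b _ _ =>
        replace a with b; [tauto|] end.
      extensionality i; destruct i; trivial; simpl.
      unfold tshift; now rewrite teval_subst. }
    split; intros H' x; apply H, H'.
  - assert (H : forall x, sat M s (scons x r) (fsubst s' (upr r') p) <->
      sat M (fun i => teval M s (s' i)) (scons x (fun i => r (r' i))) p).
    { intros x; rewrite IHp; match goal with |- sat _ _ ?a _ <-> sat _ _ ?b _ =>
        replace a with b; [tauto|] end.
      extensionality i; now destruct i. }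
    split; intros H' x; apply H, H'.
Qed.

Lemma sat_iff M s r p q :
  sat M s r (Fiff p q) <-> (sat M s r p <-> sat M s r q).
Proof. simpl; tauto. Qed.

(** [nv i] and [sv i] are the free variables [i] of a formula used at depth 0; they
    are shifted when they are moved under binders. *)
Definition nv (i : nat) : nexp := fun d => tvar (d + i).
Definition sv (i : nat) : sexp := fun e => e + i.

Definition bex (t : nexp) (f : nexp -> fexp) : fexp := ∃¹ x, x ≺ t ∧ f x.
Definition ball (t : nexp) (f : nexp -> fexp) : fexp := ∀¹ x, x ≺ t ⇒ f x.

Notation "'∃<' x 'to' t , f" := (bex t%ne (fun x => f))
  (at level 200, x name, t at level 60, right associativity) : fexp_scope.
Notation "'∀<' x 'to' t , f" := (ball t%ne (fun x => f))
  (at level 200, x name, t at level 60, right associativity) : fexp_scope.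

(** After [cbv] the bound of a quantifier appears already shifted; substituting predecessors
    recovers the term expected by [B_all] and [B_ex]. The unfolded existential is itself an
    implication, so its case precedes that of [B_imp]. *)
Ltac bounded_tac :=
  lazymatch goal with
  | |- bounded Fbot => apply B_bot
  | |- bounded (Feq _ _) => apply B_eq
  | |- bounded (Flt _ _) => apply B_lt
  | |- bounded (Fin _ _) => apply B_in
  | |- bounded (FallN (Fimp (Flt (tvar 0) ?t) _)) =>
      let u := eval cbv in (tsubst (fun i => tvar (pred i)) t) in
      apply (B_all u); bounded_tac
  | |- bounded (Fimp (FallN (Fimp (Fimp (Fimp (Flt (tvar 0) ?t)
                 (Fimp _ Fbot)) Fbot) Fbot)) Fbot) =>
      let u := eval cbv in (tsubst (fun i => tvar (pred i)) t) in
      apply (B_ex u); bounded_tac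
  | |- bounded (Fimp _ _) => apply B_imp; bounded_tac
  end.
Ltac solve_bounded := cbv; bounded_tac.

Lemma bounded_fsubst p s r : bounded p -> bounded (fsubst s r p).
Proof.
  assert (Hs : forall s t, tsubst (up s) (tshift t) = tshift (tsubst s t)).
  { intros; unfold tshift; rewrite !tsubst_comp; reflexivity. }
  intros H; revert s r; induction H; intros s r; try (constructor; auto; fail).
  - simpl; fold (up s); rewrite Hs; apply B_all, IHbounded.
  - simpl; fold (up s); rewrite Hs; apply (B_ex (tsubst s t)), IHbounded.
Qed.

Section Induction.

Variable M : model.
Hypothesis HM : models M RCA0.

Local Notation "x + y" := (madd M x y).
Local Notation "0" := (mzero M).
Local Notation "1" := (mone M).

(** Since [P] is given by [nsat], it is convertible with the predicate written natively at each use,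
    and only boundedness of the body of [∃¹ w, f w], taken at depth one, has to be checked. *)
Lemma sigma_ind (f : nexp -> fexp) s r :
  bounded (f (fun d => tvar (d - 1)) 1 0)%nat ->
  let P n := nsat M true (scons n s) r (sentence (∃¹ w, f w)) in
  P 0 -> (forall n, P n -> P (n + 1)) -> forall n, P n.
Proof.
  intros Hp P H0 HS.
  set (p := (∃¹ w, f w)%fe 0%nat 0%nat).
  assert (E : forall n, P n <-> sat M (scons n s) r p)
    by (intros n; exact (nsat_sat M p true _ _)).
  intros n; apply E; revert n.
  pose proof (HM _ s r (A_Sigma01_induction _ (Sigma01_intro _ Hp))) as H.
  apply H; intros H'; apply H'.
  - unfold instN; apply sat_subst.
    replace (fun i => _) with (scons 0 s); [now apply E|].
    extensionality i; now destruct i.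
  - intros n Hn; unfold at_succ; apply sat_subst.
    replace (fun i => _) with (scons (n + 1) s); [now apply E, HS, E|].
    extensionality i; now destruct i.
Qed.

(** Vacuous quantifiers, here and in [forall_dummy], present a bounded formula as a [Sigma01] and as
    a [Pi01] formula. *)
Lemma exists_dummy p s r :
  nsat M true s r (FexN (shiftN p)) <-> nsat M true s r p.
Proof.
  assert (H : forall w, nsat M true (scons w s) r (shiftN p) <-> nsat M true s r p).
  { intros w; rewrite !nsat_sat; unfold shiftN; apply sat_subst. }
  split; [intros [w Hw]; now apply (H w)|].
  intros Hp; exists 0; now apply H.
Qed.

Lemma forall_dummy p s r :
  nsat M true s r (FallN (shiftN p)) <-> nsat M true s r p.
Proof.
  assert (H : forall w, nsat M true (scons w s) r (shiftN p) <-> nsat M true s r p).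
  { intros w; rewrite !nsat_sat; unfold shiftN; apply sat_subst. }
  split; [intros Hp; now apply (H 0)|intros Hp w; now apply H].
Qed.

Lemma bounded_ind (f : fexp) s r : bounded (sentence f) ->
  let P n := nsat M true (scons n s) r (sentence f) in
  P 0 -> (forall n, P n -> P (n + 1)) -> forall n, P n.
Proof.
  intros Hp P H0 HS n; apply exists_dummy; revert n.
  apply (sigma_ind (fun _ _ _ => shiftN (sentence f)) s r).
  - apply bounded_fsubst, Hp.
  - apply exists_dummy, H0.
  - intros n Hn; apply exists_dummy, HS, exists_dummy, Hn.
Qed.

Lemma delta_comprehension (f g : nexp -> fexp) s r :
  bounded (f (fun d => tvar (d - 1)) 1 0)%nat ->
  bounded (g (fun d => tvar (d - 1)) 1 0)%nat ->
  let P n := nsat M true (scons n s) r (sentence (∃¹ w, f w)) in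
  (forall n, P n <-> nsat M true (scons n s) r (sentence (∀¹ w, g w))) ->
  exists X, forall n, mmem M n X <-> P n.
Proof.
  intros Hp Hq P H.
  set (p := (∃¹ w, f w)%fe 0%nat 0%nat).
  assert (E : forall n, P n <-> sat M (scons n s) r p)
    by (intros n; exact (nsat_sat M p true _ _)).
  set (q := (∀¹ w, g w)%fe 0%nat 0%nat) in *.
  assert (E' : forall n, nsat M true (scons n s) r q <-> sat M (scons n s) r q)
    by (intros n; exact (nsat_sat M q true _ _)).
  pose proof (HM _ s r (A_Delta01_comprehension _ _ (Sigma01_intro _ Hp)
    (Pi01_intro _ Hq))) as HC.
  assert (HX : exists X, forall n, mmem M n X <-> sat M (scons n s) r p).
  { apply NNPP; intros HX; apply HC.
    - intros n; apply sat_iff; split; intros Hx;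
        [apply E', H, E, Hx | apply E, H, E', Hx].
    - intros X HF; apply HX; exists X; intros n.
      specialize (HF n); apply sat_iff in HF.
      exact (iff_trans HF (sat_subst M p (scons n s) (scons X r) tvar S)). }
  destruct HX as [X HX]; exists X; intros n; now rewrite HX, E.
Qed.

Lemma bounded_comprehension (f : fexp) s r : bounded (sentence f) ->
  exists X, forall n, mmem M n X <-> nsat M true (scons n s) r (sentence f).
Proof.
  intros Hp; apply (bounded_fsubst _ (fun i => tvar (S i)) (fun X => X)) in Hp.
  destruct (delta_comprehension (fun _ _ _ => shiftN (sentence f))
    (fun _ _ _ => shiftN (sentence f)) s r Hp Hp) as [X HX].
  - intros n; exact (iff_trans (exists_dummy _ _ _)
      (iff_sym (forall_dummy _ _ _))).
  - exists X; intros n; rewrite HX; apply exists_dummy.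
Qed.

End Induction.

(** * Arithmetic in a model *)

Section Arithmetic.

Variables (M : model) (r0 : nat -> nset M).
Hypothesis HM : models M RCA0.

Local Notation "x + y" := (madd M x y).
Local Notation "x * y" := (mmul M x y).
Local Notation "x < y" := (mlt M x y).
Local Notation "0" := (mzero M).
Local Notation "1" := (mone M).

Definition env0 : nat -> num M := fun _ => 0.

Lemma msucc_neq0 x : x + 1 <> 0.
Proof. exact (HM _ (scons x env0) r0 A_succ_neq0). Qed.

Lemma msucc_inj x y : x + 1 = y + 1 -> x = y.
Proof. exact (HM _ (scons x (scons y env0)) r0 A_succ_inj). Qed.

Lemma madd0 x : x + 0 = x.
Proof. exact (HM _ (scons x env0) r0 A_add0). Qed.

Lemma maddS x y : x + (y + 1) = (x + y) + 1.
Proof. exact (HM _ (scons x (scons y env0)) r0 A_addS). Qed.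

Lemma mmul0 x : x * 0 = 0.
Proof. exact (HM _ (scons x env0) r0 A_mul0). Qed.

Lemma mmulS x y : x * (y + 1) = x * y + x.
Proof. exact (HM _ (scons x (scons y env0)) r0 A_mulS). Qed.

Lemma mlt0 x : ~ x < 0.
Proof. exact (HM _ (scons x env0) r0 A_lt0). Qed.

Lemma mltS x y : x < y + 1 <-> x < y \/ x = y.
Proof.
  pose proof (HM _ (scons x (scons y env0)) r0 A_ltS) as H.
  apply sat_iff in H; rewrite H; simpl; tauto.
Qed.

Lemma madd0l x : 0 + x = x.
Proof.
  refine (bounded_ind M HM (0 + nv 0 ≐ nv 0) env0 r0 _ _ _ x);
    [solve_bounded|simpl; apply madd0|intros n H; simpl in *].
  now rewrite maddS, H.
Qed.

Lemma maddSl x y : (x + 1) + y = (x + y) + 1.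
Proof.
  refine (bounded_ind M HM ((nv 1 + 1) + nv 0 ≐ (nv 1 + nv 0) + 1)
    (scons x env0) r0 _ _ _ y);
    [solve_bounded|simpl; now rewrite !madd0|intros n H; simpl in *].
  now rewrite !maddS, H.
Qed.

Lemma maddC x y : x + y = y + x.
Proof.
  refine (bounded_ind M HM (nv 1 + nv 0 ≐ nv 0 + nv 1)
    (scons x env0) r0 _ _ _ y);
    [solve_bounded|simpl; now rewrite madd0, madd0l|intros n H; simpl in *].
  now rewrite maddS, maddSl, H.
Qed.

Lemma maddA x y z : x + (y + z) = (x + y) + z.
Proof.
  refine (bounded_ind M HM (nv 1 + (nv 2 + nv 0) ≐ (nv 1 + nv 2) + nv 0)
    (scons x (scons y env0)) r0 _ _ _ z);
    [solve_bounded|simpl; now rewrite !madd0|intros n H; simpl in *].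
  now rewrite !maddS, H.
Qed.

Lemma mmul0l x : 0 * x = 0.
Proof.
  refine (bounded_ind M HM (0 * nv 0 ≐ 0) env0 r0 _ _ _ x);
    [solve_bounded|simpl; apply mmul0|intros n H; simpl in *].
  now rewrite mmulS, H, madd0.
Qed.

Lemma mmulSl x y : (x + 1) * y = x * y + y.
Proof.
  refine (bounded_ind M HM ((nv 1 + 1) * nv 0 ≐ nv 1 * nv 0 + nv 0)
    (scons x env0) r0 _ _ _ y);
    [solve_bounded|simpl; now rewrite !mmul0, madd0|intros n H; simpl in *].
  now rewrite !mmulS, H, !maddS, <- (maddA _ n x), (maddC n x), maddA.
Qed.

Lemma mmulC x y : x * y = y * x.
Proof.
  refine (bounded_ind M HM (nv 1 * nv 0 ≐ nv 0 * nv 1)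
    (scons x env0) r0 _ _ _ y);
    [solve_bounded|simpl; now rewrite mmul0, mmul0l|intros n H; simpl in *].
  now rewrite mmulS, mmulSl, H.
Qed.

Lemma mmulDr x y z : x * (y + z) = x * y + x * z.
Proof.
  refine (bounded_ind M HM (nv 1 * (nv 2 + nv 0) ≐ nv 1 * nv 2 + nv 1 * nv 0)
    (scons x (scons y env0)) r0 _ _ _ z);
    [solve_bounded|simpl; now rewrite mmul0, !madd0|intros n H; simpl in *].
  now rewrite maddS, !mmulS, H, maddA.
Qed.

Lemma mmulA x y z : x * (y * z) = (x * y) * z.
Proof.
  refine (bounded_ind M HM (nv 1 * (nv 2 * nv 0) ≐ (nv 1 * nv 2) * nv 0)
    (scons x (scons y env0)) r0 _ _ _ z);
    [solve_bounded|simpl; now rewrite !mmul0|intros n H; simpl in *].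
  now rewrite !mmulS, mmulDr, H.
Qed.

Lemma mmul1 x : 1 * x = x.
Proof. now rewrite <- (madd0l 1), mmulSl, mmul0l, madd0l. Qed.

Lemma msemiring : semi_ring_theory 0 1 (madd M) (mmul M) eq.
Proof.
  constructor; intros; auto using madd0l, maddC, maddA, mmul1, mmul0l, mmulC, mmulA.
  now rewrite mmulC, mmulDr, !(mmulC p).
Qed.

Add Ring model_ring : msemiring.

Lemma maddI x y z : x + z = y + z -> x = y.
Proof.
  refine (bounded_ind M HM (nv 1 + nv 0 ≐ nv 2 + nv 0 ⇒ nv 1 ≐ nv 2)
    (scons x (scons y env0)) r0 _ _ _ z);
    [solve_bounded|simpl; now rewrite !madd0|intros n H; simpl in *].
  rewrite !maddS; intros H'; now apply H, msucc_inj.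
Qed.

Lemma mzero_or_succ x : x = 0 \/ exists y, x = y + 1.
Proof.
  assert (H : exists y, x <> 0 -> x = y + 1); [|].
  { refine (sigma_ind M HM (fun y => ¬ nv 0 ≐ 0 ⇒ nv 0 ≐ y + 1) env0 r0 _ _ _ x);
      [solve_bounded|exists 0; simpl; tauto|intros n _; now exists n]. }
  destruct H as [y H]; destruct (classic (x = 0)); eauto.
Qed.

(** The axioms describe [<] only by recursion on its right argument, so the link with addition takes
    an induction in each direction. *)
Lemma mltE x y : x < y <-> exists z, y = x + (z + 1).
Proof.
  split.
  - assert (H : exists z, x < y -> y = x + (z + 1)).
    { refine (sigma_ind M HM (fun z => nv 1 ≺ nv 0 ⇒ nv 0 ≐ nv 1 + (z + 1))
       (scons x env0) r0 _ _ _ y); [solve_bounded|exists 0; now intros ?%mlt0|].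
      intros n [w Hw]; simpl in *.
      destruct (classic (x < n)) as [H|H].
      + exists (w + 1); intros _; simpl in *; now rewrite maddS, <- Hw.
      + exists 0; intros [H1|H1]%mltS; [tauto|]; simpl in *; subst; ring. }
    destruct H as [z H]; eauto.
  - intros [z ->].
    refine (bounded_ind M HM (nv 1 ≺ nv 1 + (nv 0 + 1)) (scons x env0) r0 _ _ _ z);
      [solve_bounded| |intros n H; simpl in *].
    + simpl; rewrite madd0l; apply mltS; now right.
    + rewrite maddS; apply mltS; now left.
Qed.

Lemma mlt_irrefl x : ~ x < x.
Proof.
  intros [z H]%mltE; apply (msucc_neq0 z), (maddI _ _ x).
  rewrite madd0l, maddC; auto.
Qed.

Lemma mlt_total x y : x < y \/ x = y \/ y < x.
Proof.
  assert (H : ~ x < y -> x <> y -> y < x); [|tauto].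
  refine (bounded_ind M HM (¬ nv 0 ≺ nv 1 ⇒ ¬ nv 0 ≐ nv 1 ⇒ nv 1 ≺ nv 0)
    (scons y env0) r0 _ _ _ x); [solve_bounded| |intros n H]; simpl in *.
  - destruct (mzero_or_succ y) as [->|[z ->]]; [tauto|].
    intros H; exfalso; apply H; apply mltE; exists z; ring.
  - intros H1 H2; apply mltS.
    destruct (classic (y = n)); [tauto|]; left; apply H; [|congruence].
    intros [z ->]%mltE; apply H1, mltE.
    destruct (mzero_or_succ z) as [->|[u ->]]; [|exists u; ring].
    exfalso; apply H2; ring.
Qed.

Lemma mlt_mul x y z : 0 < z -> x < y -> x * z < y * z.
Proof.
  rewrite !mltE; intros [u ->] [v ->]; exists (v * u + v + u); ring.
Qed.

Lemma mmulI x y z : 0 < z -> x * z = y * z -> x = y.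
Proof.
  intros Hz H; destruct (mlt_total x y) as [H'|[H'|H']]; trivial;
    apply (mlt_mul _ _ _ Hz) in H'; rewrite H in H'; now apply mlt_irrefl in H'.
Qed.

Lemma mlt01 : 0 < 1.
Proof. apply mltE; exists 0; ring. Qed.

End Arithmetic.

(** * The ordered field of fractions of a model *)

From HB Require Import structures.
From mathcomp Require Import all_boot all_order all_algebra.
From mathcomp Require Import boolp.

(** [set_env] provides a set: [models M RCA0] is vacuous if [M] has none. *)
Record rca_model := RcaModel {
  carrier :> model;
  set_env : nat -> nset carrier;
  carrier_models : models carrier RCA0
}.

Section Fractions.

Variable A : rca_model.
Let M := carrier A.
Let r0 := set_env A.
Let HM := carrier_models A.

Local Notation N := (num M).
Local Notation "x + y" := (madd M x y).
Local Notation "x * y" := (mmul M x y).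
Local Notation "x < y" := (mlt M x y).
Local Notation "0" := (mzero M).
Local Notation "1" := (mone M).

Add Ring model_ring : (msemiring M r0 HM).

Record prefrac := Prefrac { pnum : N; pneg : N; pden : N; pden_gt0 : 0 < pden }.

Definition frac_eq (x y : prefrac) : Prop :=
  pnum x * pden y + pneg y * pden x = pnum y * pden x + pneg x * pden y.

Lemma mul_gt0 (x y : N) : 0 < x -> 0 < y -> 0 < x * y.
Proof.
  rewrite !(mltE M r0 HM); intros [u ->] [v ->]; exists (u * v + u + v); ring.
Qed.

Lemma frac_eq_refl x : frac_eq x x.
Proof. unfold frac_eq; ring. Qed.

Lemma frac_eq_sym x y : frac_eq x y -> frac_eq y x.
Proof. unfold frac_eq; congruence. Qed.

Lemma frac_eq_trans y x z : frac_eq x y -> frac_eq y z -> frac_eq x z.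
Proof.
  unfold frac_eq; intros H1 H2.
  apply (mmulI M r0 HM _ _ (pden y)); [apply pden_gt0|].
  (* A semiring has no subtraction: adding these terms makes both sides combinations of [H1] and
     [H2]. *)
  apply (maddI M r0 HM _ _ (pneg y * pden x * pden z + pnum y * pden x * pden z)).
  transitivity ((pnum x * pden y + pneg y * pden x) * pden z +
    (pnum y * pden z + pneg z * pden y) * pden x); [ring|].
  rewrite H1 H2; ring.
Qed.

(** Chosen representatives give a quotient whose equality is Leibniz equality, as the algebraic
    structures require. *)
Definition canon (x : prefrac) : prefrac := epsilon (inhabits x) (frac_eq x).

Lemma canon_eq x : frac_eq x (canon x).
Proof.
  apply (epsilon_spec (inhabits x) (frac_eq x)); exists x; apply frac_eq_refl.
Qed.

Lemma canonP x y : frac_eq x y <-> canon x = canon y.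
Proof.
  split; intros H.
  - unfold canon; replace (frac_eq x) with (frac_eq y).
    + f_equal; apply proof_irrelevance.
    + extensionality z; apply propositional_extensionality.
      split; intros H'; eapply frac_eq_trans; eauto using frac_eq_sym.
  - apply frac_eq_trans with (canon x); [apply canon_eq|].
    rewrite H; apply frac_eq_sym, canon_eq.
Qed.

Definition mfrac : Type := {x : prefrac | canon x = x}.

Definition frac_of (x : prefrac) : mfrac :=
  exist _ (canon x) (esym (proj1 (canonP _ _) (canon_eq x))).

Lemma frac_ofP x y : frac_of x = frac_of y <-> frac_eq x y.
Proof.
  rewrite canonP; split; [now intros [=]|].
  intros H; apply eq_sig_hprop; [intros; apply proof_irrelevance|exact H].
Qed.

Lemma frac_ofK (x : mfrac) : frac_of (proj1_sig x) = x.
Proof.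
  apply eq_sig_hprop; [intros; apply proof_irrelevance|exact (proj2_sig x)].
Qed.

Definition padd (x y : prefrac) : prefrac :=
  Prefrac (pnum x * pden y + pnum y * pden x) (pneg x * pden y + pneg y * pden x)
    (pden x * pden y) (mul_gt0 _ _ (pden_gt0 x) (pden_gt0 y)).
Definition popp (x : prefrac) : prefrac :=
  Prefrac (pneg x) (pnum x) (pden x) (pden_gt0 x).
Definition pmul (x y : prefrac) : prefrac :=
  Prefrac (pnum x * pnum y + pneg x * pneg y) (pnum x * pneg y + pneg x * pnum y)
    (pden x * pden y) (mul_gt0 _ _ (pden_gt0 x) (pden_gt0 y)).
Definition pnat (n : N) : prefrac := Prefrac n 0 1 (mlt01 M r0 HM).

Lemma padd_eq x x' y y' :
  frac_eq x x' -> frac_eq y y' -> frac_eq (padd x y) (padd x' y').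
Proof.
  unfold frac_eq; simpl; intros H1 H2.
  transitivity ((pnum x * pden x' + pneg x' * pden x) * (pden y * pden y') +
    (pnum y * pden y' + pneg y' * pden y) * (pden x * pden x')); [ring|].
  rewrite H1 H2; ring.
Qed.

Lemma popp_eq x x' : frac_eq x x' -> frac_eq (popp x) (popp x').
Proof.
  unfold frac_eq; simpl; intros H.
  rewrite (maddC M r0 HM) -H; apply (maddC M r0 HM).
Qed.

Lemma pmulC x y : frac_eq (pmul x y) (pmul y x).
Proof. unfold frac_eq; simpl; ring. Qed.

Lemma pmul_eq x x' y y' :
  frac_eq x x' -> frac_eq y y' -> frac_eq (pmul x y) (pmul x' y').
Proof.
  assert (H : forall x x' y, frac_eq x x' -> frac_eq (pmul x y) (pmul x' y)).
  { clear; unfold frac_eq; simpl; intros x x' y H.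
    transitivity ((pnum x * pden x' + pneg x' * pden x) * (pnum y * pden y) +
      (pnum x' * pden x + pneg x * pden x') * (pneg y * pden y)); [ring|].
    transitivity ((pnum x' * pden x + pneg x * pden x') * (pnum y * pden y) +
      (pnum x * pden x' + pneg x' * pden x) * (pneg y * pden y)).
    - now rewrite H.
    - ring. }
  intros H1 H2; apply frac_eq_trans with (pmul x' y); [now apply H|].
  apply frac_eq_trans with (pmul y x'); [apply pmulC|].
  apply frac_eq_trans with (pmul y' x'); [now apply H|apply pmulC].
Qed.

Definition fadd (x y : mfrac) : mfrac := frac_of (padd (proj1_sig x) (proj1_sig y)).
Definition fopp (x : mfrac) : mfrac := frac_of (popp (proj1_sig x)).
Definition fmul (x y : mfrac) : mfrac := frac_of (pmul (proj1_sig x) (proj1_sig y)).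
Definition fnat (n : N) : mfrac := frac_of (pnat n).

Lemma proj_frac_of x : frac_eq (proj1_sig (frac_of x)) x.
Proof. apply frac_ofP, frac_ofK. Qed.

Lemma faddE x y : fadd (frac_of x) (frac_of y) = frac_of (padd x y).
Proof. apply frac_ofP, padd_eq; apply proj_frac_of. Qed.
Lemma foppE x : fopp (frac_of x) = frac_of (popp x).
Proof. apply frac_ofP, popp_eq; apply proj_frac_of. Qed.
Lemma fmulE x y : fmul (frac_of x) (frac_of y) = frac_of (pmul x y).
Proof. apply frac_ofP, pmul_eq; apply proj_frac_of. Qed.

Ltac frac_ring :=
  repeat match goal with x : mfrac |- _ =>
    rewrite <- (frac_ofK x); generalize (proj1_sig x); clear x; intros x end;
  unfold fnat; rewrite ?foppE ?(faddE, fmulE);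
  apply frac_ofP; unfold frac_eq; simpl; ring.

Lemma faddA : associative fadd. Proof. intros x y z; frac_ring. Qed.
Lemma faddC : commutative fadd. Proof. intros x y; frac_ring. Qed.
Lemma fadd0 : left_id (fnat 0) fadd. Proof. intros x; frac_ring. Qed.
Lemma faddN : left_inverse (fnat 0) fopp fadd. Proof. intros x; frac_ring. Qed.
Lemma fmulA : associative fmul. Proof. intros x y z; frac_ring. Qed.
Lemma fmulC : commutative fmul. Proof. intros x y; frac_ring. Qed.
Lemma fmul1 : left_id (fnat 1) fmul. Proof. intros x; frac_ring. Qed.
Lemma fmulDl : left_distributive fmul fadd. Proof. intros x y z; frac_ring. Qed.

HB.instance Definition _ := gen_eqMixin mfrac.
HB.instance Definition _ := gen_choiceMixin mfrac.

Lemma fnat_inj x y : fnat x = fnat y -> x = y.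
Proof.
  unfold fnat; rewrite frac_ofP; unfold frac_eq; simpl; intros H.
  transitivity (x * 1 + 0 * 1); [ring|]; rewrite H; ring.
Qed.

Lemma fnat1_neq0 : fnat 1 != fnat 0.
Proof.
  apply/eqP => /fnat_inj H; apply (mlt_irrefl M r0 HM 0).
  rewrite -{2}H; apply mlt01; assumption.
Qed.

HB.instance Definition _ := GRing.isZmodule.Build mfrac faddA faddC fadd0 faddN.
HB.instance Definition _ := GRing.Zmodule_isComNzRing.Build mfrac
  fmulA fmulC fmul1 fmulDl fnat1_neq0.

Lemma finv_ex (x : mfrac) : x <> fnat 0 -> exists y, fmul y x = fnat 1.
Proof.
  rewrite -(frac_ofK x); move: (proj1_sig x) => {}x Hx.
  (* The inverse of [(p - n) / d] needs a positive denominator, which is [p - n] or [n - p]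
     according to the sign. *)
  case: (mlt_total M r0 HM (pnum x) (pneg x)) => [H|[H|H]].
  - case/(mltE M r0 HM): (H) => z Hz.
    assert (H0 : 0 < z + 1) by (apply (mltE M r0 HM); exists z; ring).
    exists (frac_of (Prefrac 0 (pden x) (z + 1) H0)).
    rewrite fmulE; apply frac_ofP; unfold frac_eq; simpl; rewrite Hz; ring.
  - exfalso; apply Hx, frac_ofP; unfold frac_eq; simpl; rewrite H; ring.
  - case/(mltE M r0 HM): (H) => z Hz.
    assert (H0 : 0 < z + 1) by (apply (mltE M r0 HM); exists z; ring).
    exists (frac_of (Prefrac (pden x) 0 (z + 1) H0)).
    rewrite fmulE; apply frac_ofP; unfold frac_eq; simpl; rewrite Hz; ring.
Qed.

Definition finv (x : mfrac) : mfrac :=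
  if x == fnat 0 then fnat 0 else epsilon (inhabits x) (fun y => fmul y x = fnat 1).

Lemma fmulVf (x : mfrac) : x != 0%R -> (finv x * x = 1)%R.
Proof.
  move=> Hx; rewrite /finv (negbTE Hx).
  by apply: (epsilon_spec _ (fun y => fmul y x = fnat 1)); apply/finv_ex/eqP.
Qed.

Lemma finv0 : finv 0%R = 0%R.
Proof. by rewrite /finv eqxx. Qed.

HB.instance Definition _ := GRing.ComNzRing_isField.Build mfrac fmulVf finv0.

(** * The order of the field of fractions *)

Definition pge0 (x : prefrac) : Prop := exists z, pnum x = pneg x + z.

Lemma add_eq0 (x y : N) : x + y = 0 -> x = 0.
Proof.
  case: (mzero_or_succ M r0 HM x) => [->//|[z ->]] H.
  by case: (msucc_neq0 M r0 HM (z + y)); rewrite -H; ring.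
Qed.

Lemma pge0_eq x y : frac_eq x y -> pge0 x -> pge0 y.
Proof.
  unfold frac_eq; move=> H [z Hz].
  case: (mlt_total M r0 HM (pnum y) (pneg y)) => [|[Hy|]].
  - case/(mltE M r0 HM) => u Hu; exfalso.
    apply (mlt_irrefl M r0 HM 0); rewrite -{2}(add_eq0 ((u + 1) * pden x) (z * pden y)).
      by apply: mul_gt0; [apply (mltE M r0 HM); exists u; ring|apply pden_gt0].
    apply (maddI M r0 HM _ _ (pnum y * pden x + pneg x * pden y)).
    transitivity (pnum x * pden y + pneg y * pden x); [rewrite Hz Hu|rewrite H]; ring.
  - exists 0; rewrite Hy; ring.
  - by case/(mltE M r0 HM) => u Hu; exists (u + 1).
Qed.

Definition fge0 (x : mfrac) : bool := `[< pge0 (proj1_sig x) >].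

Lemma fge0E x : reflect (pge0 x) (fge0 (frac_of x)).
Proof.
  apply: (iffP idP) => [/asboolP|H].
    exact: (pge0_eq _ _ (proj_frac_of x)).
  by apply/asboolP; apply: (pge0_eq _ _ (frac_eq_sym _ _ (proj_frac_of x))).
Qed.

Definition fle (x y : mfrac) : bool := fge0 (y - x)%R.
Definition fnorm (x : mfrac) : mfrac := if fge0 x then x else (- x)%R.

Lemma fle0E x : fle 0%R x = fge0 x.
Proof. by rewrite /fle GRing.subr0. Qed.

Lemma fle0_add x y : fle 0%R x -> fle 0%R y -> fle 0%R (x + y)%R.
Proof.
  rewrite !fle0E -(frac_ofK x) -(frac_ofK y).
  change (frac_of ?a + frac_of ?b)%R with (fadd (frac_of a) (frac_of b)).
  rewrite faddE => /fge0E [u Hu] /fge0E [v Hv]; apply/fge0E.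
  exists (u * pden (proj1_sig y) + v * pden (proj1_sig x)); simpl; rewrite Hu Hv; ring.
Qed.

Lemma fle0_mul x y : fle 0%R x -> fle 0%R y -> fle 0%R (x * y)%R.
Proof.
  rewrite !fle0E -(frac_ofK x) -(frac_ofK y).
  change (frac_of ?a * frac_of ?b)%R with (fmul (frac_of a) (frac_of b)).
  rewrite fmulE => /fge0E [u Hu] /fge0E [v Hv]; apply/fge0E.
  exists (u * v); simpl; rewrite Hu Hv; ring.
Qed.

Lemma fge0_opp x : reflect (pge0 (popp x)) (fge0 (- frac_of x)%R).
Proof.
  change (- frac_of x)%R with (fopp (frac_of x)); rewrite foppE; apply: fge0E.
Qed.

Lemma fle_opp0 x : fle x 0%R = fge0 (- x)%R.
Proof. by rewrite /fle GRing.sub0r. Qed.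

Lemma fle0_anti x : fle 0%R x -> fle x 0%R -> x = 0%R.
Proof.
  rewrite fle0E fle_opp0 -(frac_ofK x) => /fge0E [u Hu] /fge0_opp [v Hv].
  apply/frac_ofP; unfold frac_eq; move: (proj1_sig x) Hu Hv => y Hu /= Hv.
  have Hu0 : u = 0.
    apply: (add_eq0 u v); apply (maddI M r0 HM _ _ (pneg y)).
    rewrite {2}Hv Hu; ring.
  rewrite Hu Hu0; ring.
Qed.

Lemma fsub_ge0 x y : fle 0%R (y - x)%R = fle x y.
Proof. by rewrite fle0E. Qed.

Lemma fle0_total x : fle 0%R x || fle x 0%R.
Proof.
  rewrite fle0E fle_opp0 -(frac_ofK x); move: (proj1_sig x) => {}x; apply/orP.
  case: (mlt_total M r0 HM (pnum x) (pneg x)) => [|[H|]].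
  - by case/(mltE M r0 HM) => u Hu; right; apply/fge0_opp; exists (u + 1).
  - left; apply/fge0E; exists 0; rewrite H; ring.
  - by case/(mltE M r0 HM) => u Hu; left; apply/fge0E; exists (u + 1).
Qed.

Lemma fnormN x : fnorm (- x)%R = fnorm x.
Proof.
  rewrite /fnorm GRing.opprK; have := fle0_total x; rewrite fle0E fle_opp0.
  case Hx: (fge0 x); case Hy: (fge0 (- x)%R) => // _.
  by rewrite (fle0_anti x) ?fle0E ?fle_opp0 // GRing.oppr0.
Qed.

Lemma fge0_norm x : fle 0%R x -> fnorm x = x.
Proof. by rewrite fle0E /fnorm => ->. Qed.

HB.instance Definition _ := Num.IntegralDomain_isLeReal.Build mfrac
  fle0_add fle0_mul fle0_anti fsub_ge0 fle0_total fnormN fge0_norm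
  (fun _ _ => erefl).

Local Open Scope ring_scope.
Import Order.TTheory GRing.Theory Num.Theory.

Lemma fnat0E : fnat (mzero M) = 0. Proof. by []. Qed.
Lemma fnat1E : fnat (mone M) = 1. Proof. by []. Qed.

Lemma fnatD x y : fnat (madd M x y) = fnat x + fnat y.
Proof.
  change (fnat (madd M x y) = fadd (fnat x) (fnat y)); symmetry; unfold fnat.
  rewrite faddE; apply frac_ofP; unfold frac_eq; simpl; ring.
Qed.

Lemma fnatM x y : fnat (mmul M x y) = fnat x * fnat y.
Proof.
  change (fnat (mmul M x y) = fmul (fnat x) (fnat y)); symmetry; unfold fnat.
  rewrite fmulE; apply frac_ofP; unfold frac_eq; simpl; ring.
Qed.

Lemma fnat_ge0 x : 0 <= fnat x.
Proof.
  change (fle 0 (fnat x)); rewrite fle0E; apply/fge0E; exists x; simpl; ring.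
Qed.

Lemma fnat_lt x y : (mlt M x y) <-> fnat x < fnat y.
Proof.
  have H a b : mlt M a b -> fnat a < fnat b.
    case/(mltE M r0 HM) => z ->; rewrite !fnatD ltrDl ltr_wpDl ?fnat_ge0 //.
  split=> [|Hxy]; first exact: H.
  case: (mlt_total M r0 HM x y) => [//|[E|/H]]; first by rewrite E ltxx in Hxy.
  by move=> /(lt_trans Hxy); rewrite ltxx.
Qed.

Lemma fnat_le x y : ~ (mlt M y x) <-> fnat x <= fnat y.
Proof.
  rewrite fnat_lt leNgt; split; [by move/negP|by move=> H; apply/negP].
Qed.

Lemma fnat_ltS x y : fnat x < fnat y + 1 <-> fnat x <= fnat y.
Proof.
  rewrite -fnat1E -fnatD -fnat_lt (mltS M r0 HM) le_eqVlt fnat_lt.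
  split=> [[->|->]|/orP[/eqP/fnat_inj|]]; rewrite ?eqxx ?orbT //; tauto.
Qed.

Lemma frac_ofE x :
  frac_of x = (fnat (pnum x) - fnat (pneg x)) / fnat (pden x).
Proof.
  have Hd : fnat (pden x) != 0.
    rewrite gt_eqF //; change (fnat (mzero M) < fnat (pden x)).
    apply fnat_lt, pden_gt0.
  apply: (mulIf Hd); rewrite mulfVK //; apply/eqP.
  rewrite eq_sym subr_eq eq_sym; apply/eqP.
  change (fadd (fmul (frac_of x) (fnat (pden x))) (fnat (pneg x)) = fnat (pnum x)).
  unfold fnat; rewrite fmulE faddE; apply frac_ofP; unfold frac_eq; simpl; ring.
Qed.

End Fractions.

Arguments fnat {A}.
#[global] Opaque fnat.

From mathcomp Require Import ring lra.
Import Order.TTheory GRing.Theory Num.Theory.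
Local Open Scope ring_scope.

(** * Discreteness of the numbers and the pairing map *)

Section Coding.

Variable A : rca_model.

Let HM := carrier_models A.

Local Notation N := (num A).
Local Notation K := (mfrac A).
Local Notation "x +' y" := (madd A x y) (at level 50, left associativity).
Local Notation "x *' y" := (mmul A x y) (at level 40, left associativity).
Local Notation "x <' y" := (mlt A x y) (at level 70).
Local Notation n0 := (mzero A).
Local Notation n1 := (mone A).
Local Notation env := (env0 A).
Local Notation fnat := (@fnat A).

Definition fnatE := (@fnatD A, @fnatM A, fnat0E A, fnat1E A).

Ltac nring := apply: (@fnat_inj A); rewrite !fnatE; ring.

Lemma fnat_gt0 x : n0 <' x <-> 0 < fnat x.
Proof. by rewrite fnat_lt. Qed.

Lemma fnat_leS x y : x <' y +' n1 <-> fnat x <= fnat y.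
Proof. by rewrite fnat_lt fnatD fnat1E fnat_ltS. Qed.

(** Discreteness, in the form in which linear arithmetic over the field can use it. *)
Lemma fnat_ltE x y : fnat x < fnat y <-> fnat x + 1 <= fnat y.
Proof.
  have := fnat_ltS A (x +' n1) y; rewrite fnatD fnat1E => <-.
  by split; lra.
Qed.

Lemma fnat_gt0E x : 0 < fnat x <-> 1 <= fnat x.
Proof. by rewrite -(fnat0E A) fnat_ltE fnat0E add0r. Qed.

Lemma fnat_sub x y : fnat x <= fnat y -> exists z, y = x +' z.
Proof.
  rewrite -fnat_leS (mltE A (set_env A) HM) => -[z Hz]; exists z.
  apply: (@msucc_inj A (set_env A) HM); rewrite Hz; nring.
Qed.

(** The code lies between [(x + y)^2] and [(x + y + 1)^2], the latter excluded; so the sum is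
    determined, and with it [x]. *)
Lemma mpair_inj x y x' y' : mpair A x y = mpair A x' y' -> x = x' /\ y = y'.
Proof.
  move=> /(f_equal fnat); rewrite /mpair !fnatE => H.
  have [Hx Hy Hx' Hy'] : [/\ 0 <= fnat x, 0 <= fnat y, 0 <= fnat x' & 0 <= fnat y'].
    by split; apply: fnat_ge0.
  have E : fnat (x +' y) = fnat (x' +' y').
    case: (ltgtP (fnat (x +' y)) (fnat (x' +' y'))) => //;
      rewrite fnat_ltE !fnatE; nra.
  rewrite !fnatE in E; rewrite E in H.
  have Ex : fnat x = fnat x' by lra.
  by split; apply: (@fnat_inj A) => //; lra.
Qed.

Lemma mpair_mono x y x' y' : fnat x <= fnat x' -> fnat y <= fnat y' ->
  fnat (mpair A x y) <= fnat (mpair A x' y').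
Proof.
  rewrite /mpair !fnatE; have := fnat_ge0 A x; have := fnat_ge0 A y; nra.
Qed.

Lemma mpair_gel x y : fnat x <= fnat (mpair A x y).
Proof. by rewrite /mpair !fnatE; have := sqr_ge0 (fnat x + fnat y); lra. Qed.

Lemma mpair_ger x y : fnat y <= fnat (mpair A x y).
Proof.
  rewrite /mpair !fnatE; have := fnat_ge0 A x; have := fnat_ge0 A y.
  case: (EM (n0 <' y)) => [/fnat_gt0/fnat_gt0E|/fnat_le]; rewrite ?fnat0E; nra.
Qed.

(** * Finite sets coded by numbers *)

(** The integers of the model inside its field; the Bezout coefficients of the moduli below may be
    negative. *)
Definition zint (x : K) : Prop := exists a b : N, x = fnat a - fnat b.

Lemma zint_nat (n : N) : zint (fnat n).
Proof. by exists n, n0; rewrite fnat0E subr0. Qed.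

Lemma zintB x y : zint x -> zint y -> zint (x - y).
Proof.
  by move=> [a [b ->]] [c [d ->]]; exists (a +' d), (b +' c); rewrite !fnatE; ring.
Qed.

Lemma zintM x y : zint x -> zint y -> zint (x * y).
Proof.
  move=> [a [b ->]] [c [d ->]]; exists (a *' c +' b *' d), (a *' d +' b *' c).
  by rewrite !fnatE; ring.
Qed.

Lemma zint_ge0 x : zint x -> 0 <= x -> exists n, x = fnat n.
Proof.
  move=> [a [b ->]]; rewrite subr_ge0 => /fnat_sub [z ->]; exists z.
  by rewrite fnatD; ring.
Qed.

(** As in Goedel's beta function, [c] and [d] code the set of those [x] for which
    [(x + 1) * d + 1] divides [c]. *)
Definition codes (c d x : nexp) : fexp :=
  ∃< z to c + 1, c ≐ z * ((x + 1) * d + 1).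
Definition modulus (d x : N) : N := (x +' n1) *' d +' n1.
Definition mcodes (c d x : N) : Prop :=
  exists z, z <' c +' n1 /\ c = z *' modulus d x.

(** A modulus is at least 1, so the quotient never exceeds [c]; the explicit bound is there to keep
    [codes] a bounded formula. *)
Lemma mcodesP c d x : mcodes c d x <-> exists z, c = z *' modulus d x.
Proof.
  split=> [[z [_ Hz]]|[z Hz]]; exists z => //; split=> //.
  rewrite fnat_leS Hz /modulus !fnatE.
  have := fnat_ge0 A z; have := fnat_ge0 A x; have := fnat_ge0 A d.
  move=> h1 h2 h3; have : 0 <= (fnat x + 1) * fnat d by nra.
  nra.
Qed.

(** Stands in for the factorial of [B], which cannot be defined by recursion before finite sets are
    coded. *)
Lemma common_multiple B :
  exists d, n0 <' d /\
    forall i, i <' B -> exists z, z <' d +' n1 /\ d = z *' (i +' n1).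
Proof.
  pose P n := exists d, n0 <' d /\
    forall i, i <' n -> exists z, z <' d +' n1 /\ d = z *' (i +' n1).
  refine (sigma_ind A HM (fun d => 0 ≺ d ∧ ∀< i to nv 0, ∃< z to d + 1,
    d ≐ z * (i + 1))%fe env (set_env A) _ (_ : P n0)
    (_ : forall n, P n -> P (n +' n1)) B); first solve_bounded.
  - by exists n1; split=> [|i /(mlt0 A (set_env A) HM)//]; apply/fnat_gt0/ltr01.
  - move=> n [d [Hd IH]]; exists (d *' (n +' n1)).
    move/fnat_gt0: Hd => Hd; have Hn := fnat_ge0 A n; split.
      by rewrite fnat_gt0 !fnatE mulr_gt0 //; lra.
    move=> i /(mltS A (set_env A) HM) [/IH [z [Hz E]]|->].
      exists (z *' (n +' n1)); split; last by rewrite {1}E; nring.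
      by move: Hz; rewrite !fnat_leS /= !fnatE; nra.
    by exists d; split=> //; rewrite fnat_leS !fnatE; nra.
Qed.

(** The moduli are pairwise coprime: with [d = f * (j - i)],
    [1 = m_i * (1 - (i+1)(j+1)f) + m_j * (i+1)^2 f]. *)
Lemma modulus_cancel B d c i j :
  (forall i, i <' B -> exists z, z <' d +' n1 /\ d = z *' (i +' n1)) ->
  i <' B -> j <' B -> i <> j ->
  (exists z, c *' modulus d j = z *' modulus d i) -> exists z, c = z *' modulus d i.
Proof.
  move=> Hd Hi Hj Hij [z Hz].
  have [f [Hf Ef]] : exists f, zint f /\ fnat d = f * (fnat j - fnat i).
    have H i' j' : i' <' j' -> j' <' B ->
        exists f, fnat d = fnat f * (fnat j' - fnat i').
      move=> /(mltE A (set_env A) HM) [e He] HB.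
      have [|f [_ Ef]] := Hd e.
        move: HB; rewrite !fnat_lt He !fnatE; have := fnat_ge0 A i'; lra.
      by exists f; rewrite {1}Ef He !fnatE; ring.
    case: (mlt_total A (set_env A) HM i j) => [Hlt|[//|Hlt]].
      by have [f Ef] := H _ _ Hlt Hj; exists (fnat f); split=> //; exact: zint_nat.
    have [f Ef] := H _ _ Hlt Hi; exists (fnat n0 - fnat f).
    by split; [apply: zintB; apply: zint_nat|rewrite Ef fnat0E; ring].
  pose m := fnat (modulus d i).
  pose q : K := fnat c * (1 - (fnat i + 1) * (fnat j + 1) * f) +
    (fnat i + 1) * (fnat i + 1) * f * fnat z.
  have Hm : 0 < m.
    rewrite /m /modulus !fnatE; have := fnat_ge0 A i; have := fnat_ge0 A d; nra.
  have Eq : fnat c = q * m.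
    have E2 : fnat c * fnat (modulus d j) = fnat z * m by rewrite -!fnatM Hz fnatM.
    have -> : q * m = fnat c * m * (1 - (fnat i + 1) * (fnat j + 1) * f) +
       (fnat i + 1) * (fnat i + 1) * f * (fnat z * m) by rewrite /q; ring.
    by rewrite -E2 /m /modulus !fnatE Ef; ring.
  have Hq : zint q.
    have H1 : zint 1 by rewrite -(fnat1E A); apply: zint_nat.
    have Hs (x : N) : zint (fnat x + 1) by rewrite -fnat1E -fnatD; apply: zint_nat.
    have -> : q = fnat c * (1 - (fnat i + 1) * (fnat j + 1) * f) -
      (fnat n0 - (fnat i + 1) * (fnat i + 1) * f * fnat z) by rewrite /q fnat0E; ring.
    exact: (zintB _ _ (zintM _ _ (zint_nat _) (zintB _ _ H1
      (zintM _ _ (zintM _ _ (Hs _) (Hs _)) Hf))) (zintB _ _ (zint_nat _)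
      (zintM _ _ (zintM _ _ (zintM _ _ (Hs _) (Hs _)) Hf) (zint_nat _)))).
  have [|n En] := zint_ge0 q Hq.
    by rewrite -(pmulr_lge0 _ Hm) -Eq fnat_ge0.
  by exists n; apply: (@fnat_inj A); rewrite fnatM Eq En.
Qed.

(** Induction on [n] with [B] fixed: [c] is multiplied by the modulus of [n] whenever [n] belongs to
    [X], and [modulus_cancel] shows that no other index below [B] is added by this. *)
Lemma coding X B :
  exists c d, forall i, i <' B -> (mcodes c d i <-> mmem A i X).
Proof.
  have [d [Hd0 Hd]] := common_multiple B.
  move/fnat_gt0: Hd0 => Hd0.
  suff [c Hc] : exists c, forall i, i <' B ->
      (mcodes c d i -> i <' B /\ mmem A i X) /\ (i <' B -> mmem A i X -> mcodes c d i).
    exists c, d => i Hi; have [H1 H2] := Hc i Hi.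
    by split=> [/H1[]|]; [|apply: H2].
  pose P n := exists c, forall i, i <' B ->
      (mcodes c d i -> i <' n /\ mmem A i X) /\ (i <' n -> mmem A i X -> mcodes c d i).
  refine (sigma_ind A HM (fun c => ∀< i to nv 2,
    (codes c (nv 1) i ⇒ i ≺ nv 0 ∧ i ∈ sv 0) ∧
    (i ≺ nv 0 ⇒ i ∈ sv 0 ⇒ codes c (nv 1) i))%fe
    (scons d (scons B env)) (scons X (set_env A)) _ (_ : P n0)
    (_ : forall n, P n -> P (n +' n1)) B); first solve_bounded.
  (* As [d] is positive, every modulus exceeds 1, and 1 codes the empty set. *)
  - exists n1 => i Hi; split=> [[z [Hz E]]|/(mlt0 A (set_env A) HM)//].
    exfalso; move: E => /(f_equal fnat); rewrite /modulus !fnatE => E.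
    have Hid : 0 < (fnat i + 1) * fnat d by have := fnat_ge0 A i; nra.
    case: (EM (n0 <' z)) => [/fnat_gt0/fnat_gt0E|/fnat_le]; rewrite ?fnat0E => H.
      by have : 0 <= (fnat z - 1) * ((fnat i + 1) * fnat d + 1); nra.
    have Hz0 : fnat z = 0 by have := fnat_ge0 A z; lra.
    by rewrite Hz0 in E; lra.
  - move=> n [c Hc].
    case: (EM (n <' B /\ mmem A n X)) => [[HnB HnX]|Hn]; last first.
      exists c => i Hi; have [H1 H2] := Hc i Hi; split=> [/H1[Hin HX]|].
        by split=> //; apply/(mltS A (set_env A) HM); left.
      move=> /(mltS A (set_env A) HM) [|E] HX; first by move/H2; apply.
      by rewrite E in Hi HX; case: Hn.
    exists (c *' modulus d n) => i Hi; have [H1 H2] := Hc i Hi.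
    case: (EM (i = n)) => [->|Hin].
      split=> _; first by split=> //; apply/(mltS A (set_env A) HM); right.
      by move=> _; apply/mcodesP; exists c.
    have E : mcodes (c *' modulus d n) d i <-> mcodes c d i.
      rewrite !mcodesP; split=> [|[z ->]]; first exact: (modulus_cancel B).
      by exists (z *' modulus d n); nring.
    rewrite E; split=> [/H1[Hlt HX]|].
      by split=> //; apply/(mltS A (set_env A) HM); left.
    by move=> /(mltS A (set_env A) HM) [|//]; apply: H2.
Qed.


End Coding.

(** * Powers of two *)

Section PowersOfTwo.

Variable A : rca_model.

Let HM := carrier_models A.

Local Notation N := (num A).
Local Notation K := (mfrac A).
Local Notation "x +' y" := (madd A x y) (at level 50, left associativity).
Local Notation "x *' y" := (mmul A x y) (at level 40, left associativity).
Local Notation "x <' y" := (mlt A x y) (at level 70).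
Local Notation n0 := (mzero A).
Local Notation n1 := (mone A).
Local Notation n2 := (n1 +' n1).
Local Notation env := (env0 A).
Local Notation senv := (set_env A).
Local Notation fnat := (@fnat A).
Local Notation fnatE := (@fnatE A).
Local Notation mpair := (mpair A).
Local Notation mcodes := (mcodes A).

Ltac nring := apply: (@fnat_inj A); rewrite !fnatE; ring.

(** [c] and [d] code a set containing [(k, y)] and closed under the unfolding
    of the recursion for powers of two below [(k, y)]. *)
Definition hist (c d k y : nexp) : fexp :=
  codes c d (pair k y) ∧
  ∀< i to k + 1, ∀< v to y + 1, codes c d (pair i v) ⇒ ¬ (i ≐ 0 ∧ v ≐ 1) ⇒
    ∃< j to i, ∃< u to v + 1, i ≐ j + 1 ∧ v ≐ 2 * u ∧ codes c d (pair j u).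

Definition mhist (c d k y : N) : Prop :=
  mcodes c d (mpair k y) /\
  forall i, i <' k +' n1 -> forall v, v <' y +' n1 -> mcodes c d (mpair i v) ->
    (i = n0 -> v <> n1) ->
    exists j, j <' i /\ exists u, u <' v +' n1 /\
      i = j +' n1 /\ v = n2 *' u /\ mcodes c d (mpair j u).

Lemma hist_zero : exists c d, mhist c d n0 n1.
Proof.
  have [X HX] : exists X, forall x, mmem A x X <-> x = mpair n0 n1.
    exact: (bounded_comprehension A HM (nv 0 ≐ pair 0 1) env senv
      (B_eq _ _)).
  have [c [d Hcd]] := coding A X (mpair n0 n1 +' n1).
  exists c, d; split; first by apply/Hcd; [apply/fnat_leS|apply/HX].
  move=> i Hi v Hv Hc.
  have /HX/mpair_inj [-> ->] : mmem A (mpair i v) X.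
    by apply/Hcd => //; apply/fnat_leS/mpair_mono; apply/fnat_leS.
  by move=> H; case: (H erefl erefl).
Qed.

(** The coded set is cut down to the pairs within [k] and [y] before the new pair is added: other
    pairs that [c] and [d] happen to code could violate the closure condition for the larger
    bounds. *)
Lemma hist_succ c d k y : mhist c d k y ->
  exists c' d', mhist c' d' (k +' n1) (n2 *' y).
Proof.
  move=> [H1 H2].
  have [X HX] : exists X, forall x, mmem A x X <->
      (x <> mpair (k +' n1) (n2 *' y) -> exists i, i <' k +' n1 /\
         exists v, v <' y +' n1 /\ x = mpair i v /\ mcodes c d x).
    refine (bounded_comprehension A HM (¬ nv 0 ≐ pair (nv 1 + 1) (2 * nv 2) ⇒
       ∃< i to nv 1 + 1, ∃< v to nv 2 + 1,
       nv 0 ≐ pair i v ∧ codes (nv 3) (nv 4) (nv 0))%fe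
       (scons k (scons y (scons c (scons d env)))) senv _).
    solve_bounded.
  have [c' [d' Hcd]] := coding A X (mpair (k +' n1) (n2 *' y) +' n1).
  have Hcode i v : fnat i <= fnat k -> fnat v <= fnat y ->
      mcodes c' d' (mpair i v) <-> mcodes c d (mpair i v).
    move=> Hi Hv; rewrite Hcd; last first.
      apply/fnat_leS/mpair_mono; rewrite !fnatE; first by lra.
      by have := fnat_ge0 A y; lra.
    rewrite HX; split=> [[|i' [_ [v' [_ [_ //]]]]]|H _].
      by move/mpair_inj => [Ei _]; move: Hi; rewrite Ei !fnatE; lra.
    exists i; split; first exact/fnat_leS.
    by exists v; split; first exact/fnat_leS.
  exists c', d'; split.
    by apply/Hcd; [apply/fnat_leS|apply/HX].
  move=> i /fnat_leS Hi v /fnat_leS Hv Hc Hiv.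
  have /HX Hx : mmem A (mpair i v) X.
    by apply/Hcd => //; apply/fnat_leS/mpair_mono.
  case: (EM (mpair i v = mpair (k +' n1) (n2 *' y))) => [|Hn]; last first.
    have [i' [/fnat_leS Hi' [v' [/fnat_leS Hv' [/mpair_inj [E1 E2] Hc']]]]] := Hx Hn.
    subst i' v'.
    have [||j [Hj [u [Hu [Ei [Ev Hcu]]]]]] := H2 i _ v _ Hc' Hiv; try exact/fnat_leS.
    exists j; split=> //; exists u; split=> //; split=> //; split=> //.
    apply/Hcode => //.
      by move: Hi'; rewrite Ei !fnatE; lra.
    by move/fnat_leS: Hu; lra.
  move/mpair_inj => [-> ->].
  exists k; split; first by apply/fnat_leS.
  exists y; split; last by split=> //; split=> //; apply/Hcode.
  by apply/fnat_leS; rewrite !fnatE; have := fnat_ge0 A y; lra.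
Qed.

Lemma hist_total k : exists y c d, mhist c d k y.
Proof.
  (* One unbounded [w] above all witnesses leaves a single unbounded quantifier, as [Sigma01]
     demands. *)
  pose P k := exists w y, y <' w /\ exists c, c <' w /\ exists d, d <' w /\ mhist c d k y.
  suff [w [y [_ [c [_ [d [_ H]]]]]]] : P k by exists y, c, d.
  have HP k' c d y : mhist c d k' y -> P k'.
    move=> H; exists (y +' c +' d +' n1), y.
    have := fnat_ge0 A y; have := fnat_ge0 A c; have := fnat_ge0 A d => ? ? ?.
    split; first by apply/fnat_leS; rewrite !fnatE; lra.
    exists c; split; first by apply/fnat_leS; rewrite !fnatE; lra.
    by exists d; split; first by apply/fnat_leS; rewrite !fnatE; lra.
  refine (sigma_ind A HM (fun w => ∃< y to w, ∃< c to w, ∃< d to w,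
    hist c d (nv 0) y)%fe env senv _ (_ : P n0)
    (_ : forall k, P k -> P (k +' n1)) k); first solve_bounded.
  - by have [c [d /HP]] := hist_zero.
  - by move=> n [_ [y [_ [c [_ [d [_ /hist_succ [c' [d' /HP]]]]]]]]].
Qed.

(** A coded pair other than [(0, 1)] is tied to its predecessor, so agreement of two histories
    climbs from [i = 0], where a value different from 1 would need a predecessor with a smaller
    index. *)
Lemma hist_unique c d c' d' k y y' : mhist c d k y -> mhist c' d' k y' -> y = y'.
Proof.
  move=> [H1 H2] [H1' H2'].
  suff H : forall i, i <' k +' n1 -> forall v, v <' y +' n1 ->
      forall v', v' <' y' +' n1 ->
      mcodes c d (mpair i v) -> mcodes c' d' (mpair i v') -> v = v'.
    by apply: (H k) => //; apply/fnat_leS.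
  pose P i := i <' k +' n1 -> forall v, v <' y +' n1 -> forall v', v' <' y' +' n1 ->
      mcodes c d (mpair i v) -> mcodes c' d' (mpair i v') -> v = v'.
  move=> i; refine (bounded_ind A HM (nv 0 ≺ nv 1 + 1 ⇒ ∀< v to nv 2 + 1,
    ∀< v' to nv 3 + 1, codes (nv 4) (nv 5) (pair (nv 0) v) ⇒
    codes (nv 6) (nv 7) (pair (nv 0) v') ⇒ v ≐ v')%fe
    (scons k (scons y (scons y' (scons c (scons d (scons c' (scons d' env)))))))
    senv _ (_ : P n0) (_ : forall i, P i -> P (i +' n1)) i).
  - solve_bounded.
  - have H c1 d1 y1 (H : mhist c1 d1 k y1) v :
        n0 <' k +' n1 -> v <' y1 +' n1 -> mcodes c1 d1 (mpair n0 v) -> v = n1.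
      move=> Hk Hv Hc; apply: NNPP => Hn; have [_ /(_ _ Hk _ Hv Hc)] := H.
      by case=> // j [/(mlt0 A senv HM)].
    move=> Hk v Hv v' Hv' Hc Hc'; rewrite (H c d y (conj H1 H2) v Hk Hv Hc).
    by rewrite (H c' d' y' (conj H1' H2') v' Hk Hv' Hc').
  - move=> n IH Hn v Hv v' Hv' Hc Hc'.
    have Hn0 : n +' n1 = n0 -> False := msucc_neq0 A senv HM n.
    have [|j [_ [u [Hu [Ej [-> Hcu]]]]]] := H2 _ Hn _ Hv Hc; first by move/Hn0.
    have [|j' [_ [u' [Hu' [Ej' [-> Hcu']]]]]] := H2' _ Hn _ Hv' Hc'; first by move/Hn0.
    move/(msucc_inj A senv HM): Ej Ej' => <- /(msucc_inj A senv HM) <- in Hcu Hcu' *.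
    move: Hn Hv Hv' Hu Hu'; rewrite !fnat_leS !fnatE => Hn Hv Hv' Hu Hu'.
    rewrite (IH _ u _ u') //; rewrite fnat_leS; lra.
Qed.

(** The graph is [Delta01]: that [y] ends some history is equivalent to its being the end of every
    history, by [hist_unique] and [hist_total]. *)
Lemma exp2_set : exists E, mIsExp2 A E.
Proof.
  pose P n := exists w k, k <' n +' n1 /\ exists y, y <' n +' n1 /\ n = mpair k y /\
     exists c, c <' w /\ exists d, d <' w /\ mhist c d k y.
  pose Q n := forall w, exists k, k <' n +' n1 /\ exists y, y <' n +' n1 /\
     n = mpair k y /\ forall y', y' <' w -> forall c, c <' w -> forall d, d <' w ->
     mhist c d k y' -> y = y'.
  have HP k y : P (mpair k y) <-> exists c d, mhist c d k y.
    split=> [[w [k' [_ [y' [_ [/mpair_inj [<- <-] [c [_ [d [_ H]]]]]]]]]]|[c [d H]]].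
      by exists c, d.
    exists (c +' d +' n1), k; split; first by apply/fnat_leS/mpair_gel.
    exists y; split; first by apply/fnat_leS/mpair_ger.
    split=> //; have := fnat_ge0 A c; have := fnat_ge0 A d => ? ?.
    exists c; split; first by apply/fnat_leS; rewrite !fnatE; lra.
    by exists d; split; first by apply/fnat_leS; rewrite !fnatE; lra.
  have [E HE] : exists E, forall n, mmem A n E <-> P n.
    refine (delta_comprehension A HM
      (fun w => ∃< k to nv 0 + 1, ∃< y to nv 0 + 1, nv 0 ≐ pair k y ∧
         ∃< c to w, ∃< d to w, hist c d k y)%fe
      (fun w => ∃< k to nv 0 + 1, ∃< y to nv 0 + 1, nv 0 ≐ pair k y ∧
         ∀< y' to w, ∀< c to w, ∀< d to w, hist c d k y' ⇒ y ≐ y')%fe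
      env senv _ _ (_ : forall n, P n <-> Q n)).
    - solve_bounded.
    - solve_bounded.
    - move=> n; split.
        move=> [w [k [Hk [y [Hy [En [c [_ [d [_ H]]]]]]]]]] w'.
        exists k; split=> //; exists y; split=> //; split=> // y' _ c' _ d' _.
        exact: hist_unique H.
      (* With bound 0 the universal part is vacuous, and [HQ] only exhibits [n] as a pair. It is
         used again with a bound above an actual history. *)
      move=> HQ; have [k [_ [y [_ [En _]]]]] := HQ n0.
      have [y' [c [d H]]] := hist_total k.
      rewrite En; apply/HP; exists c, d.
      have [k' [_ [y'' [_ [+ H']]]]] := HQ (y' +' c +' d +' n1).
      rewrite En => /mpair_inj [Ek Ey]; subst k' y''.
      have -> // : y = y'.
      have := fnat_ge0 A c; have := fnat_ge0 A d; have := fnat_ge0 A y' => ? ? ?.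
      by apply: (H' _ _ c _ d) => //; apply/fnat_leS; rewrite !fnatE; lra.
  have HEP k y : mmem A (mpair k y) E <-> exists c d, mhist c d k y by rewrite HE.
  exists E; split; [|split; [|split]].
  - by move=> k; have [y [c [d H]]] := hist_total k; exists y; apply/HEP; exists c, d.
  - by move=> k y z /HEP [c [d H]] /HEP [c' [d' H']]; exact: (hist_unique _ _ _ _ _ _ _ H H').
  - exact/HEP/hist_zero.
  - by move=> k y /HEP [c [d /hist_succ H]]; apply/HEP.
Qed.

(** [pow2] speaks of some set [E]; independence of that set makes it functional. *)
Lemma exp2_set_unique E E' k y z : mIsExp2 A E -> mIsExp2 A E' ->
  mmem A (mpair k y) E -> mmem A (mpair k z) E' -> y = z.
Proof.
  move=> [_ [HE1 [HE2 HE3]]] [_ [HE1' [HE2' HE3']]] Hy Hz.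
  pose P k := exists y, mmem A (mpair k y) E /\ mmem A (mpair k y) E'.
  have [u [Hu Hu']] : P k.
    refine (sigma_ind A HM (fun y => pair (nv 0) y ∈ sv 0 ∧ pair (nv 0) y ∈ sv 1)%fe
      env (scons E (scons E' senv)) _ (_ : P n0)
      (_ : forall k, P k -> P (k +' n1)) k); first solve_bounded.
    - by exists n1.
    - by move=> n [u [/HE3 Hu /HE3' Hu']]; exists (n2 *' u).
  by rewrite (HE1 _ _ _ Hy Hu) (HE1' _ _ _ Hz Hu').
Qed.

Definition exp2 (k : N) : N := epsilon (inhabits n0) (mpow2 A k).

Lemma mpow2P k y : mpow2 A k y <-> y = exp2 k.
Proof.
  have [E HE] := exp2_set.
  have H0 : exists y, mpow2 A k y.
    by have [/(_ k) [z Hz] _] := HE; exists z, E.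
  have H : mpow2 A k (exp2 k) := epsilon_spec (inhabits n0) (mpow2 A k) H0.
  split=> [[E1 [HE1 H1]]|-> //].
  by have [E2 [HE2 H2]] := H; apply: (exp2_set_unique E1 E2 k).
Qed.

Lemma exp2_S k : exp2 (k +' n1) = n2 *' exp2 k.
Proof.
  apply/esym/mpow2P; have [E [HE H]] : mpow2 A k (exp2 k) by apply/mpow2P.
  by exists E; split=> //; apply HE.
Qed.

Lemma exp2_gt k : fnat k + 1 <= fnat (exp2 k).
Proof.
  have [E HE] := exp2_set.
  pose P k := exists y, mmem A (mpair k y) E /\ k <' y.
  have [y [Hy Hk]] : P k.
    refine (sigma_ind A HM (fun y => pair (nv 0) y ∈ sv 0 ∧ nv 0 ≺ y)%fe
      env (scons E senv) _ (_ : P n0) (_ : forall k, P k -> P (k +' n1)) k).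
    - solve_bounded.
    - by exists n1; split; [apply HE|apply/fnat_gt0; rewrite fnatE].
    - move=> n [y [Hy /fnat_lt Hn]]; exists (n2 *' y); split; first by apply HE.
      move: Hn; rewrite !fnat_lt fnat_ltE !fnatE; have := fnat_ge0 A n; lra.
  have <- : y = exp2 k by apply/mpow2P; exists E.
  by move: Hk; rewrite fnat_lt fnat_ltE.
Qed.

Definition eps (k : N) : K := (fnat (exp2 k))^-1.

Lemma exp2_gt0 k : 0 < fnat (exp2 k).
Proof. by have := exp2_gt k; have := fnat_ge0 A k; lra. Qed.

Lemma eps_gt0 k : 0 < eps k.
Proof. by rewrite invr_gt0 exp2_gt0. Qed.

Lemma epsS k : eps (k +' n1) = eps k / 2.
Proof. by rewrite /eps exp2_S !fnatE invfM mulrC. Qed.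

(** Archimedean relative to the possibly nonstandard numbers of the model: [(p - n) / d <= p], since
    [d] is at least 1. *)
Lemma fnat_archimedean (x : K) : exists n, x <= fnat n.
Proof.
  have [y ->] : exists y, x = frac_of A y by exists (proj1_sig x); rewrite frac_ofK.
  exists (pnum A y); rewrite frac_ofE.
  have Hd : 0 < fnat (pden A y) by apply/fnat_gt0/pden_gt0.
  rewrite ler_pdivrMr //; move/fnat_gt0E: Hd => Hd.
  have := fnat_ge0 A (pneg A y); have := fnat_ge0 A (pnum A y); nra.
Qed.

Lemma eps_small (x : K) k : 0 < x -> exists i, eps (k +' i) < x.
Proof.
  move=> Hx; have [n Hn] := fnat_archimedean x^-1; exists n.
  rewrite -(invrK x) ltf_pV2 ?posrE ?invr_gt0 ?exp2_gt0 //.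
  have := exp2_gt (k +' n); rewrite fnatD; have := fnat_ge0 A k; lra.
Qed.

(** * Rational numbers of a model *)

Definition mqval (q : mrat A) : K :=
  (fnat (mpos A q) - fnat (mneg A q)) / fnat (mden A q).

Definition mqvalid (q : mrat A) : Prop := n0 <' mden A q.

Lemma mcode_inj q r : mcode A q = mcode A r -> q = r.
Proof. by case: q r => [a b c] [a' b' c'] /mpair_inj /= [/mpair_inj [-> ->] ->]. Qed.

Lemma mnleP x y : mnle A x y <-> fnat x <= fnat y.
Proof.
  rewrite /mnle le_eqVlt; split=> [H|/orP[/eqP/fnat_inj|] Hxy H].
  - apply/orP; case: (EM (x <' y)) => [/fnat_lt|/H ->]; [by right|by left].
  - exact: Hxy.
  - by case: H; apply/fnat_lt.
Qed.

Lemma mqleP q r : mqvalid q -> mqvalid r -> (mqle A q r <-> mqval q <= mqval r).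
Proof.
  move=> /fnat_gt0 Hq /fnat_gt0 Hr; rewrite /mqle mnleP !fnatE.
  rewrite /mqval ler_pdivrMr // mulrAC ler_pdivlMr //.
  by split; lra.
Qed.

Lemma mqaddE q r : mqvalid q -> mqvalid r -> mqval (mqadd A q r) = mqval q + mqval r.
Proof.
  move=> /fnat_gt0 Hq /fnat_gt0 Hr.
  rewrite /mqval addf_div ?gt_eqF //= !fnatE; congr (_ / _); ring.
Qed.

Lemma mqadd_valid q r : mqvalid q -> mqvalid r -> mqvalid (mqadd A q r).
Proof. by rewrite /mqvalid !fnat_gt0 /= fnatE; apply: mulr_gt0. Qed.

Lemma mqltP q r : mqvalid q -> mqvalid r -> (mqlt A q r <-> mqval q < mqval r).
Proof.
  move=> Hq Hr; have E := mqleP r q Hr Hq; rewrite ltNge; split.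
    by move=> [H1 H2]; apply/negP => /E H; apply/H2/H.
  move=> /negP H; split=> H'; apply: H; apply/E; first by move=> H; case: (H H').
  by move=> _.
Qed.

End PowersOfTwo.

(** * Metric spaces in a model *)

Section Space.

Variable A : rca_model.

Let HM := carrier_models A.

Local Notation N := (num A).
Local Notation K := (mfrac A).
Local Notation "x +' y" := (madd A x y) (at level 50, left associativity).
Local Notation "x *' y" := (mmul A x y) (at level 40, left associativity).
Local Notation "x <' y" := (mlt A x y) (at level 70).
Local Notation n0 := (mzero A).
Local Notation n1 := (mone A).
Local Notation n2 := (n1 +' n1).
Local Notation n3 := (n1 +' n1 +' n1).
Local Notation env := (env0 A).
Local Notation senv := (set_env A).
Local Notation fnat := (@fnat A).
Local Notation fnatE := (@fnatE A).
Local Notation mpair := (mpair A).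
Local Notation mem := (mmem A).
Local Notation fval := (mqval A).
Local Notation eps := (eps A).
Local Notation valid := (mqvalid A).
Local Notation MQ := (MQ A).

Ltac nring := apply: (@fnat_inj A); rewrite !fnatE; ring.

Lemma mallQP (f : mrat A -> Prop) : mallQ A f <-> forall q, valid q -> f q.
Proof. by split=> [H [p n d]|H p n d]; [exact: (H p n d)|exact: (H (MQ p n d))]. Qed.

Lemma mexQP (f : mrat A -> Prop) : mexQ A f <-> exists2 q, valid q & f q.
Proof.
  split=> [[p [n [d [Hd H]]]]|[[p n d] Hd H]]; first by exists (MQ p n d).
  by exists p, n, d.
Qed.

(** Reals of the statement are relations; [t] lists the terms. Only codes with positive denominator
    are constrained, as the quantifiers over rationals see no others. *)
Definition graph_of (x : mreal A) (t : N -> mrat A) : Prop :=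
  forall k, valid (t k) /\ forall q, valid q -> (x k q <-> q = t k).

Lemma graph_eq {x t k q} : graph_of x t -> valid q -> x k q <-> q = t k.
Proof. by move=> H Hq; have [_ /(_ _ Hq)] := H k. Qed.

Lemma exp2_valid a b k : valid (MQ a b (exp2 A k)).
Proof. by apply/fnat_gt0/exp2_gt0. Qed.

Lemma fval_eps a k : fval (MQ a n0 (exp2 A k)) = fnat a * eps k.
Proof. by rewrite /mqval /= fnatE subr0. Qed.

Lemma mrltP x y t u : graph_of x t -> graph_of y u ->
  (mrlt A x y <-> exists k, fval (t k) + 2 * eps k < fval (u k)).
Proof.
  move=> Hx Hy.
  have E k : mqlt A (mqadd A (t k) (MQ n2 n0 (exp2 A k))) (u k) <->
      fval (t k) + 2 * eps k < fval (u k).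
    have [Ht _] := Hx k; have [Hu _] := Hy k; have Hk := exp2_valid n2 n0 k.
    by rewrite mqltP ?mqaddE ?fval_eps ?fnatE //; apply: mqadd_valid.
  split.
    move=> [k [z /mexQP [q Hq /mexQP [r Hr [/(graph_eq Hy Hq) H1 [/(graph_eq Hx Hr) H2 [/mpow2P -> H3]]]]]]].
    by exists k; apply/E; rewrite -H1 // -H2.
  move=> [k /E H]; have [Ht Ht'] := Hx k; have [Hu Hu'] := Hy k.
  exists k, (exp2 A k); apply/mexQP; exists (u k) => //; apply/mexQP; exists (t k) => //.
  by rewrite Ht' // Hu' // mpow2P.
Qed.

Lemma mrleP x y t u : graph_of x t -> graph_of y u ->
  (mrle A x y <-> forall k, fval (t k) <= fval (u k) + 2 * eps k).
Proof.
  move=> Hx Hy.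
  have E k : mqle A (t k) (mqadd A (u k) (MQ n2 n0 (exp2 A k))) <->
      fval (t k) <= fval (u k) + 2 * eps k.
    have [Ht _] := Hx k; have [Hu _] := Hy k; have Hk := exp2_valid n2 n0 k.
    by rewrite mqleP ?mqaddE ?fval_eps ?fnatE //; apply: mqadd_valid.
  split=> H k.
    have [Ht Ht'] := Hx k; have [Hu Hu'] := Hy k.
    apply/E; have /mallQP /(_ _ Ht) /mallQP /(_ _ Hu) := H k (exp2 A k).
    by rewrite Ht' // Hu' // mpow2P; apply.
  move=> z; apply/mallQP => q Hq; apply/mallQP => r Hr.
  by move=> /(graph_eq Hx Hq) -> /(graph_eq Hy Hr) -> /mpow2P ->; apply/E.
Qed.

Definition rterm (x : mreal A) (k : N) : mrat A :=
  epsilon (inhabits (mqzero A)) (fun q => valid q /\ x k q).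

Lemma rterm_graph x : mIsReal A x -> graph_of x (rterm x).
Proof.
  move=> [H1 [H2 _]] k.
  have [Hv Hx] : valid (rterm x k) /\ x k (rterm x k).
    apply: (epsilon_spec _ (fun q => valid q /\ x k q)).
    by have /mexQP [q Hq Hxq] := H1 k; exists q.
  split=> // q Hq; split=> [Hxq|-> //].
  by have /mallQP /(_ _ Hq) /mallQP /(_ _ Hv Hxq Hx) /mcode_inj := H2 k.
Qed.

Lemma rterm_cauchy x k i : mIsReal A x ->
  fval (rterm x k) <= fval (rterm x (k +' i)) + eps k /\
  fval (rterm x (k +' i)) <= fval (rterm x k) + eps k.
Proof.
  move=> Hx; have Hg := rterm_graph x Hx; have [_ [_ H3]] := Hx.
  have [Hk Hk'] := Hg k; have [Hi Hi'] := Hg (k +' i).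
  have /mallQP /(_ _ Hk) /mallQP /(_ _ Hi) := H3 k i (exp2 A k).
  have He := exp2_valid n1 n0 k.
  rewrite Hk' // Hi' // mpow2P => /(_ erefl erefl erefl) [].
  rewrite !mqleP ?mqaddE ?fval_eps ?fnatE ?mul1r //; exact: mqadd_valid.
Qed.

Lemma graph_mrrat q : valid q -> graph_of (mrrat A q) (fun _ => q).
Proof.
  by move=> Hq k; split=> // r _; split=> [/mcode_inj|->].
Qed.

Lemma graph_mrpow2inv n :
  graph_of (mrpow2inv A n) (fun _ => MQ n1 n0 (exp2 A n)).
Proof.
  move=> k; split=> [|q _]; first exact: exp2_valid.
  split=> [[y [/mpow2P -> /mcode_inj //]]|->].
  by exists (exp2 A n); rewrite mpow2P.
Qed.

Lemma graph_mradd x y t u : graph_of x t -> graph_of y u ->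
  graph_of (mradd A x y) (fun k => mqadd A (t (k +' n1)) (u (k +' n1))).
Proof.
  move=> Hx Hy k; have [Ht Ht'] := Hx (k +' n1); have [Hu Hu'] := Hy (k +' n1).
  split=> [|s Hs]; first exact: mqadd_valid.
  split.
    by move=> /mexQP [q Hq /mexQP [r Hr [/Ht' -> // [/Hu' -> // /mcode_inj]]]].
  move=> ->; apply/mexQP; exists (t (k +' n1)) => //; apply/mexQP.
  by exists (u (k +' n1)) => //; rewrite Ht' // Hu'.
Qed.

Variables S D : nset A.
Hypothesis HS : mIsSpace A S D.

Local Notation "a ∈ X" := (mmem A a X) (at level 70).

Definition dterm (a b k : N) : mrat A := rterm (mdist A D a b) k.
Definition delta (a b k : N) : K := fval (dterm a b k).

Lemma dist_real a b : a ∈ S -> b ∈ S -> mIsReal A (mdist A D a b).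
Proof. by case: HS => H _; apply: H. Qed.

Lemma dist_graph a b : a ∈ S -> b ∈ S -> graph_of (mdist A D a b) (dterm a b).
Proof. by move=> Ha Hb; apply/rterm_graph/dist_real. Qed.

(** The real number d(a, b) is at most [t]. *)
Definition dle (a b : N) (t : K) : Prop := forall k, delta a b k <= t + eps k.

Lemma delta_cauchy a b k i : a ∈ S -> b ∈ S ->
  delta a b k <= delta a b (k +' i) + eps k /\
  delta a b (k +' i) <= delta a b k + eps k.
Proof. by move=> Ha Hb; apply/rterm_cauchy/dist_real. Qed.

(** Any multiple of [eps k] is as good as one: the Cauchy condition compares [k] with a later index
    at which [C * eps] is smaller than a supposed excess. *)
Lemma dle_limit a b t C : 0 < C -> a ∈ S -> b ∈ S ->
  (forall k, delta a b k <= t + C * eps k) -> dle a b t.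
Proof.
  move=> HC Ha Hb H k; rewrite leNgt; apply/negP => Hk.
  have [|i Hi] := eps_small A ((delta a b k - t - eps k) / C) k.
    by rewrite divr_gt0 //; lra.
  rewrite ltr_pdivlMr // in Hi.
  have [H1 _] := delta_cauchy a b k i Ha Hb; have := H (k +' i); lra.
Qed.

Lemma dle_weaken a b t u : t <= u -> dle a b t -> dle a b u.
Proof. by move=> Htu H k; have := H k; lra. Qed.

Lemma dle_approx a b k : a ∈ S -> b ∈ S -> dle a b (delta a b k + eps k).
Proof.
  move=> Ha Hb l; have Hk := eps_gt0 A k; have Hl := eps_gt0 A l.
  case: (leP (fnat k) (fnat l)) => [|/ltW] /fnat_sub [i ->].
    by have [_] := delta_cauchy a b k i Ha Hb; have := eps_gt0 A (k +' i); lra.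
  by have [+ _] := delta_cauchy a b l i Ha Hb; have := eps_gt0 A (l +' i); lra.
Qed.

(** Produces a witness for the strict inequality, a [Sigma01] condition; [dle_approx] leads back
    from such a witness to an upper bound. *)
Lemma dle_lt a b t u : dle a b t -> t < u -> exists k, delta a b k + eps k < u.
Proof.
  move=> H Htu; have [|i Hi] := eps_small A ((u - t) / 2) n0; first by lra.
  by exists (n0 +' i); have := H (n0 +' i); lra.
Qed.

Lemma dle_refl a : a ∈ S -> dle a a 0.
Proof.
  move=> Ha; apply: (dle_limit _ _ _ 2) => // k.
  have Hz : valid (mqzero A) by apply/fnat_gt0; rewrite fnatE.
  have [_ [/(_ a Ha) [/(mrleP _ _ _ _ (dist_graph _ _ Ha Ha) (graph_mrrat _ Hz))]]] := HS.
  by move=> /(_ k); rewrite {2}/mqval /= !fnatE subrr mul0r.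
Qed.

Lemma dle_sym a b t : a ∈ S -> b ∈ S -> dle a b t -> dle b a t.
Proof.
  move=> Ha Hb H; apply: (dle_limit _ _ _ 3) => // k.
  have [_ [_ [/(_ b a Hb Ha) [[+ _] _]]]] := HS.
  move/(mrleP _ _ _ _ (dist_graph _ _ Hb Ha) (dist_graph _ _ Ha Hb)) => /(_ k).
  by have := H k; rewrite /delta; lra.
Qed.

Lemma dle_trans a b c s t : a ∈ S -> b ∈ S -> c ∈ S ->
  dle a c s -> dle c b t -> dle a b (s + t).
Proof.
  (* The constant 3 collects [2 * eps k] from the order of reals and two errors [eps (k + 1)] from
     the summands, which are read one index later. *)
  move=> Ha Hb Hc Hs Ht; apply: (dle_limit _ _ _ 3) => // k.
  have [_ [_ [_ /(_ a b c Ha Hb Hc)]]] := HS.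
  have Hac := dist_graph _ _ Ha Hc; have Hcb := dist_graph _ _ Hc Hb.
  move/(mrleP _ _ _ _ (dist_graph _ _ Ha Hb) (graph_mradd _ _ _ _ Hac Hcb)) => /(_ k).
  rewrite mqaddE; [|by have [] := Hac (k +' n1)|by have [] := Hcb (k +' n1)].
  by have := Hs (k +' n1); have := Ht (k +' n1); rewrite /delta epsS; lra.
Qed.

(** * Points and balls *)

Definition point_of (x : mpoint A) (f : N -> N) : Prop :=
  forall n, f n ∈ S /\ forall a, x n a <-> a = f n.

Lemma isPoint_point_of x : mIsPoint A S D x -> exists f, point_of x f.
Proof.
  move=> [H1 [H2 _]]; exists (fun n => epsilon (inhabits n0) (fun a => a ∈ S /\ x n a)).
  move=> n; set b := epsilon _ _.
  have [Hb Hx] : b ∈ S /\ x n b := epsilon_spec _ _ (H1 n).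
  by split=> // a; split=> [Ha|->//]; apply: H2 Ha Hx.
Qed.

Lemma point_const a : a ∈ S -> point_of (mpconst A a) (fun _ => a).
Proof. by []. Qed.

Lemma graph_mpdist x y f g : point_of x f -> point_of y g ->
  graph_of (mpdist A D x y)
    (fun k => dterm (f (k +' n3)) (g (k +' n3)) (k +' n3)).
Proof.
  move=> Hx Hy k; have [Hf Hf'] := Hx (k +' n3); have [Hg Hg'] := Hy (k +' n3).
  have [Hv H] := dist_graph _ _ Hf Hg (k +' n3); split=> // q Hq; rewrite -H //.
  split=> [[a [b [/Hf' -> [/Hg' ->]]]] //|Hd].
  by exists (f (k +' n3)), (g (k +' n3)); rewrite Hf' Hg'.
Qed.

Lemma inBallE x y rho f g q : graph_of rho (fun _ => q) ->
  point_of x f -> point_of y g ->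
  (mInBall A D x rho y <->
   exists k, delta (f (k +' n3)) (g (k +' n3)) (k +' n3) + 2 * eps k < fval q).
Proof. by move=> Hq Hx Hy; apply: mrltP => //; apply: graph_mpdist. Qed.

Lemma point_step x f n : mIsPoint A S D x -> point_of x f ->
  exists2 t, t < eps n & dle (f n) (f (n +' n1)) t.
Proof.
  move=> [_ [_ H]] Hf; have [Hn Hn'] := Hf n; have [Hm Hm'] := Hf (n +' n1).
  have := H n (f n) (f (n +' n1)); rewrite Hn' Hm' => /(_ erefl erefl).
  move/(mrltP _ _ _ _ (dist_graph _ _ Hn Hm) (graph_mrpow2inv n)) => [k].
  rewrite fval_eps fnatE mul1r => Hk.
  exists (delta (f n) (f (n +' n1)) k + eps k); last exact: dle_approx.
  by have := eps_gt0 A k; rewrite /delta; lra.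
Qed.

Lemma fval_sub a b k l : fval (mqadd A (MQ a n0 (exp2 A k)) (MQ n0 b (exp2 A l))) =
  fnat a * eps k - fnat b * eps l.
Proof.
  rewrite mqaddE ?fval_eps; try exact: exp2_valid.
  by rewrite /mqval /= fnatE sub0r mulNr.
Qed.

Lemma point_telescope X f n i : mIsPoint A S D (mpset A X) ->
  point_of (mpset A X) f ->
  dle (f n) (f (n +' i)) (3 * eps n - 2 * eps (n +' i)).
Proof.
  move=> HX Hf.
  (* [pow2] hides a set quantifier; with a fixed [E] as parameter, powers of two can occur in a
     bounded formula. *)
  have [E HE] := exp2_set A.
  have HE' k y : mem (mpair k y) E <-> y = exp2 A k.
    split=> [H|->]; first by apply/mpow2P; exists E.
    by have [/(_ k) [y' Hy'] _] := HE; have <- : y' = exp2 A k by apply/mpow2P; exists E.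
  have HfX m a : mem (mpair m a) X <-> a = f m by have [_] := Hf m; apply.
  pose P i := exists k, delta (f n) (f (n +' i)) k + eps k <
    3 * eps n - 2 * eps (n +' i).
  suff HP : forall i, P i.
    have [k Hk] := HP i; have [Hn _] := Hf n; have [Hm _] := Hf (n +' i).
    by apply: dle_weaken (dle_approx _ _ k Hn Hm); lra.
  (* This is [P] with every term of the sequences and of the distance named, under one bound [w]. *)
  pose P' i := exists w a, a <' w /\ exists b, b <' w /\ exists k, k <' w /\
    exists p, p <' w /\ exists m, m <' w /\ exists d, d <' w /\
    exists y, y <' w /\ exists z, z <' w /\ exists u, u <' w /\
    mem (mpair n a) X /\ mem (mpair (n +' i) b) X /\ n0 <' d /\
    mem (mpair (mpair (mpair a b) k) (mpair (mpair p m) d)) D /\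
    mem (mpair n y) E /\ mem (mpair (n +' i) z) E /\ mem (mpair k u) E /\
    mqlt A (mqadd A (MQ p m d) (MQ n1 n0 u))
           (mqadd A (MQ n3 n0 y) (MQ n0 n2 z)).
  have HPP j : P' j <-> P j.
    have [Hn _] := Hf n; have [Hm _] := Hf (n +' j).
    have HT := dist_graph _ _ Hn Hm.
    have Hlt k : mqlt A (mqadd A (dterm (f n) (f (n +' j)) k) (MQ n1 n0 (exp2 A k)))
           (mqadd A (MQ n3 n0 (exp2 A n)) (MQ n0 n2 (exp2 A (n +' j)))) <->
        delta (f n) (f (n +' j)) k + eps k < 3 * eps n - 2 * eps (n +' j).
      have [Hv _] := HT k; have He := exp2_valid n1 n0 k.
      rewrite mqltP; try (apply: mqadd_valid => //; exact: exp2_valid).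
      by rewrite fval_sub mqaddE // fval_eps !fnatE /delta; split; lra.
    split.
      move=> [w [a [_ [b [_ [k [_ [p [_ [m [_ [d [_ [y [_ [z [_ [u [_]]]]]]]]]]]]]]]]]]].
      move=> [/HfX -> [/HfX -> [Hd [Hpmd [/HE' -> [/HE' -> [/HE' -> H]]]]]]].
      have Epmd : MQ p m d = dterm (f n) (f (n +' j)) k by apply/(graph_eq HT).
      by exists k; apply/Hlt; rewrite -Epmd.
    move=> [k /Hlt]; have [] := HT k.
    case: (dterm _ _ k) => p m d Hd /(_ (MQ p m d) Hd) [_ /(_ erefl) Hpmd] Hq.
    exists (f n +' f (n +' j) +' k +' p +' m +' d +' exp2 A n +' exp2 A (n +' j) +'
      exp2 A k +' n1).
    have Hg x := fnat_ge0 A x.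
    have := Hg (f n); have := Hg (f (n +' j)); have := Hg k; have := Hg p.
    have := Hg m; have := Hg d; have := Hg (exp2 A n); have := Hg (exp2 A (n +' j)).
    have := Hg (exp2 A k) => ? ? ? ? ? ? ? ? ?.
    exists (f n); split; first by apply/fnat_leS; rewrite !fnatD; lra.
    exists (f (n +' j)); split; first by apply/fnat_leS; rewrite !fnatD; lra.
    exists k; split; first by apply/fnat_leS; rewrite !fnatD; lra.
    exists p; split; first by apply/fnat_leS; rewrite !fnatD; lra.
    exists m; split; first by apply/fnat_leS; rewrite !fnatD; lra.
    exists d; split; first by apply/fnat_leS; rewrite !fnatD; lra.
    exists (exp2 A n); split; first by apply/fnat_leS; rewrite !fnatD; lra.
    exists (exp2 A (n +' j)); split; first by apply/fnat_leS; rewrite !fnatD; lra.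
    exists (exp2 A k); split; first by apply/fnat_leS; rewrite !fnatD; lra.
    do 2 (split; first by apply/HfX).
    do 2 (split; first by []); do 3 (split; first by apply/HE').
    exact: Hq.
  move=> j; apply/HPP; move: j.
  refine (sigma_ind A HM (fun w => ∃< a to w, ∃< b to w, ∃< k to w, ∃< p to w,
      ∃< m to w, ∃< d to w, ∃< y to w, ∃< z to w, ∃< u to w,
      pair (nv 1) a ∈ sv 0 ∧ pair (nv 1 + nv 0) b ∈ sv 0 ∧ 0 ≺ d ∧
      pair (pair (pair a b) k) (pair (pair p m) d) ∈ sv 1 ∧
      pair (nv 1) y ∈ sv 2 ∧ pair (nv 1 + nv 0) z ∈ sv 2 ∧ pair k u ∈ sv 2 ∧
      qlt (qadd (Q p m d) (Q 1 0 u)) (qadd (Q 3 0 y) (Q 0 2 z)))%fe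
    (scons n env) (scons X (scons D (scons E senv)))
    _ (_ : P' n0) (_ : forall j, P' j -> P' (j +' n1))); first solve_bounded.
  - apply/HPP; have [Hn _] := Hf n.
    have E0 : n +' n0 = n by nring.
    (* For [i = 0] the bound is [eps n], positive because the leading constant is 3 and not 2. *)
    rewrite /P E0; apply: (dle_lt _ _ 0); first exact: dle_refl.
    by have := eps_gt0 A n; lra.
  - move=> j /HPP [k Hk]; apply/HPP.
    have E0 : n +' (j +' n1) = n +' j +' n1 by nring.
    have [Hn _] := Hf n; have [Hm _] := Hf (n +' j); have [Hm' _] := Hf (n +' j +' n1).
    have [t Ht Hdt] := point_step _ _ (n +' j) HX Hf.
    have Hd := dle_trans _ _ _ _ _ Hn Hm' Hm (dle_approx _ _ k Hn Hm) Hdt.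
    (* The step adds less than [eps (n + j)], which is what the subtracted [2 * eps (n + j)] gives
       up when it is halved. *)
    by rewrite /P E0; apply: (dle_lt _ _ _ _ Hd); rewrite epsS; lra.
Qed.

Lemma point_tail X f n i : mIsPoint A S D (mpset A X) -> point_of (mpset A X) f ->
  dle (f n) (f (n +' i)) (3 * eps n).
Proof.
  move=> HX Hf; apply: dle_weaken (point_telescope _ _ n i HX Hf).
  by have := eps_gt0 A (n +' i); lra.
Qed.

Lemma eps3 k : eps (k +' n3) = eps k / 8.
Proof.
  have -> : k +' n3 = k +' n1 +' n1 +' n1 by nring.
  by rewrite !epsS; field.
Qed.

(** Turns the diagonal approximation of the distance into a bound along a whole tail, to which the
    triangle inequality applies. The shift by 3 pays for the tail: [4 * eps (k + 3) = eps k / 2]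
    fits into the slack [2 * eps k] of the strict order. *)
Lemma inBall_const X f a q : valid q -> a ∈ S ->
  mIsPoint A S D (mpset A X) -> point_of (mpset A X) f ->
  (mInBall A D (mpconst A a) (mrrat A q) (mpset A X) <->
   exists k, exists2 t, t < fval q & forall i, dle a (f (k +' i)) t).
Proof.
  move=> /graph_mrrat Hq Ha HX Hf.
  rewrite (inBallE _ _ _ _ _ _ Hq (point_const _ Ha) Hf).
  split=> [[k Hk]|[k [t Ht H]]].
    set l := k +' n3 in Hk; have [Hl _] := Hf l.
    exists l, (delta a (f l) l + eps l + 3 * eps l).
      by have := eps_gt0 A k; rewrite {2 3}/l eps3; lra.
    move=> i; have [Hi _] := Hf (l +' i).
    apply: (dle_trans _ _ (f l)) => //; first exact: dle_approx.
    exact: point_tail HX Hf.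
  (* Room is needed for the slack [2 * eps] and an error of [eps / 8] at index [k + i]; a third of
     the difference allows for both. *)
  have [|i Hi] := eps_small A ((fval q - t) / 3) k; first by lra.
  exists (k +' i); have E : k +' i +' n3 = k +' (i +' n3) by nring.
  have := H (i +' n3) (k +' i +' n3); rewrite -E eps3; have := eps_gt0 A (k +' i); lra.
Qed.

Lemma inBall_points X Y rho f g q : graph_of rho (fun _ => q) ->
  mIsPoint A S D (mpset A X) -> point_of (mpset A X) f ->
  mIsPoint A S D (mpset A Y) -> point_of (mpset A Y) g ->
  mInBall A D (mpset A X) rho (mpset A Y) ->
  exists k, exists2 t, t < fval q & forall i, dle (f (k +' i)) (g (k +' i)) t.
Proof.
  move=> Hq HX Hf HY Hg /(inBallE _ _ _ _ _ _ Hq Hf Hg) [k Hk].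
  set l := k +' n3 in Hk; have [Hfl _] := Hf l; have [Hgl _] := Hg l.
  (* Two tails and one approximation cost [7 * eps l], less than the [2 * eps k] available in
     [Hk]. *)
  exists l, (3 * eps l + (delta (f l) (g l) l + eps l + 3 * eps l)).
    by have := eps_gt0 A k; rewrite {1 3 4}/l eps3; lra.
  move=> i; have [Hfi _] := Hf (l +' i); have [Hgi _] := Hg (l +' i).
  apply: (dle_trans _ _ (f l)) => //.
    by apply: dle_sym => //; apply: point_tail HX Hf.
  apply: (dle_trans _ _ (g l)) => //; first exact: dle_approx.
  exact: point_tail HY Hg.
Qed.

End Space.

(** * The shrunk covering and the Lebesgue number *)

Section HeineBorel.

Variable A : rca_model.

Let HM := carrier_models A.

Local Notation N := (num A).
Local Notation K := (mfrac A).
Local Notation "x +' y" := (madd A x y) (at level 50, left associativity).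
Local Notation "x *' y" := (mmul A x y) (at level 40, left associativity).
Local Notation "x <' y" := (mlt A x y) (at level 70).
Local Notation n0 := (mzero A).
Local Notation n1 := (mone A).
Local Notation n2 := (n1 +' n1).
Local Notation n3 := (n1 +' n1 +' n1).
Local Notation env := (env0 A).
Local Notation senv := (set_env A).
Local Notation fnat := (@fnat A).
Local Notation fnatE := (@fnatE A).
Local Notation mpair := (mpair A).
Local Notation mem := (mmem A).
Local Notation fval := (mqval A).
Local Notation eps := (eps A).
Local Notation valid := (mqvalid A).
Local Notation MQ := (MQ A).

Ltac nring := apply: (@fnat_inj A); rewrite !fnatE; ring.
Local Notation "a ∈ X" := (mmem A a X) (at level 70).

(** The pairing map is not onto; indices that are not codes of triples are read as
    that of [(0, 0, 0)]. *)
Definition decode (i n k j : nexp) : fexp :=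
  ¬ i ≐ pair (pair n k) j ⇒ n ≐ 0 ∧ k ≐ 0 ∧ j ≐ 0 ∧
    ∀< n' to i + 1, ∀< k' to i + 1, ∀< j' to i + 1, ¬ i ≐ pair (pair n' k') j'.

Definition mdecode (i n k j : N) : Prop :=
  i <> mpair (mpair n k) j -> n = n0 /\ k = n0 /\ j = n0 /\
    forall n', n' <' i +' n1 -> forall k', k' <' i +' n1 ->
    forall j', j' <' i +' n1 -> i <> mpair (mpair n' k') j'.

Lemma code_bound n k j (i := mpair (mpair n k) j) :
  [/\ fnat n <= fnat i, fnat k <= fnat i & fnat j <= fnat i].
Proof.
  split; last exact: mpair_ger.
  - exact: le_trans (mpair_gel A _ _) (mpair_gel A _ _).
  - exact: le_trans (mpair_ger A _ _) (mpair_gel A _ _).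
Qed.

Lemma decode_bound i n k j : mdecode i n k j ->
  [/\ fnat n <= fnat i, fnat k <= fnat i & fnat j <= fnat i].
Proof.
  move=> H; case: (EM (i = mpair (mpair n k) j)) => [->|]; first exact: code_bound.
  by move/H => [-> [-> [-> _]]]; rewrite fnatE fnat_ge0.
Qed.

(** A sequence of open sets must have balls at every index, including those that code no triple. *)
Lemma decode_total i : exists n k j, mdecode i n k j.
Proof.
  case: (EM (exists n k j, i = mpair (mpair n k) j)) => [[n [k [j Hi]]]|H].
    by exists n, k, j.
  exists n0, n0, n0 => _; do 3 (split; first by []).
  by move=> n _ k _ j _ Hi; apply: H; exists n, k, j.
Qed.

Lemma decode_code n k j n' k' j' : mdecode (mpair (mpair n k) j) n' k' j' ->
  [/\ n' = n, k' = k & j' = j].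
Proof.
  move=> H; case: (EM (mpair (mpair n k) j = mpair (mpair n' k') j')).
    by move=> /mpair_inj [/mpair_inj [-> ->] ->].
  move/H => [_ [_ [_ H']]]; have [Hn Hk Hj] := code_bound n k j.
  by case: (H' n _ k _ j) => //; apply/fnat_leS.
Qed.

Lemma decode_unique i n k j n' k' j' : mdecode i n k j -> mdecode i n' k' j' ->
  [/\ n' = n, k' = k & j' = j].
Proof.
  move=> H H'; case: (EM (i = mpair (mpair n k) j)) => [Hi|Hi].
    by apply: decode_code; rewrite -Hi.
  case: (EM (i = mpair (mpair n' k') j')) => [Hi'|Hi'].
    by rewrite Hi' in H; have [-> -> ->] := decode_code _ _ _ _ _ _ H.
  by have [-> [-> [-> _]]] := H Hi; have [-> [-> [-> _]]] := H' Hi'.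
Qed.

(** The fraction is deliberately not reduced: for positive [q] the numerator is at least 1, so the
    reciprocal of the new denominator is at most the gap [q / (j + 2)]. *)
Definition shrink (q : mrat A) (j : N) : mrat A :=
  MQ (mpos A q *' (j +' n1)) (mneg A q *' (j +' n1)) (mden A q *' (j +' n2)).

Lemma shrink_valid q j : valid q -> valid (shrink q j).
Proof.
  rewrite /mqvalid !fnat_gt0 /= !fnatE => Hq; apply: mulr_gt0 => //.
  by have := fnat_ge0 A j; lra.
Qed.

Lemma shrinkE q j : valid q ->
  fval (shrink q j) = fval q - fval q / (fnat j + 2).
Proof.
  move=> /fnat_gt0 Hq; have Hj := fnat_ge0 A j.
  have Hj2 : fnat j + 2 != 0 by rewrite gt_eqF //; lra.
  rewrite -[X in _ = X - _]mulr1 -mulrBr /mqval /= !fnatE -mulrBl -mulf_div.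
  congr (_ * _); apply: (mulIf Hj2); rewrite mulrBl (mulVf Hj2) mul1r.
  by rewrite -[1 + 1]/2 (mulfVK Hj2); ring.
Qed.

(** The right-hand side does not mention [l]: each open set of [V] is one ball repeated, so the gap
    is determined by the index [i]. *)
Lemma shrunk_balls U : exists V, forall i l b q, mballAt A V i l b q <->
  exists n k j, mdecode i n k j /\
    exists2 q0, valid q0 & mballAt A U n k b q0 /\ q = shrink q0 j.
Proof.
  (* Each component is bounded by a code containing it, and [p], [m], [d] by their multiples [P],
     [R], [T]; so bounded comprehension suffices. *)
  pose PV x := exists i, i <' x +' n1 /\ exists l, l <' x +' n1 /\
    exists b, b <' x +' n1 /\ exists P, P <' x +' n1 /\ exists R, R <' x +' n1 /\
    exists T, T <' x +' n1 /\ x = mpair (mpair i l) (mpair b (mpair (mpair P R) T)) /\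
    exists n, n <' i +' n1 /\ exists k, k <' i +' n1 /\ exists j, j <' i +' n1 /\
    mdecode i n k j /\ exists p, p <' P +' n1 /\ exists m, m <' R +' n1 /\
    exists d, d <' T +' n1 /\ n0 <' d /\
    mpair (mpair n k) (mpair b (mpair (mpair p m) d)) ∈ U /\
    P = p *' (j +' n1) /\ R = m *' (j +' n1) /\ T = d *' (j +' n2).
  have [V HV] : exists V, forall x, x ∈ V <-> PV x.
    refine (bounded_comprehension A HM (∃< i to nv 0 + 1, ∃< l to nv 0 + 1,
      ∃< b to nv 0 + 1, ∃< P to nv 0 + 1, ∃< R to nv 0 + 1, ∃< T to nv 0 + 1,
      nv 0 ≐ pair (pair i l) (pair b (pair (pair P R) T)) ∧
      ∃< n to i + 1, ∃< k to i + 1, ∃< j to i + 1, decode i n k j ∧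
      ∃< p to P + 1, ∃< m to R + 1, ∃< d to T + 1, 0 ≺ d ∧
      pair (pair n k) (pair b (pair (pair p m) d)) ∈ sv 0 ∧
      P ≐ p * (j + 1) ∧ R ≐ m * (j + 1) ∧ T ≐ d * (j + 2))%fe
      env (scons U senv) _).
    solve_bounded.
  exists V => i l b q; rewrite /mballAt HV; split.
    move=> [i' [_ [l' [_ [b' [_ [P [_ [R [_ [T [_ [+ H]]]]]]]]]]]]].
    case: q => P' R' T' /mpair_inj [/mpair_inj [Ei _] /mpair_inj [Eb]].
    move=> /mpair_inj [/mpair_inj /= [EP ER] /= ET]; subst i' b' P' R' T'.
    move: H => [n [_ [k [_ [j [_ [Hdec [p [_ [m [_ [d [_ [Hd [HU [-> [-> ->]]]]]]]]]]]]]]]]].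
    by exists n, k, j; split=> //; exists (MQ p m d).
  move=> [n [k [j [Hdec [[p m d] Hd [HU ->]]]]]].
  have [Hn Hk Hj] := decode_bound _ _ _ _ Hdec.
  rewrite /mcode /shrink /=; set x := mpair (mpair i l) _.
  have Hx1 : fnat (mpair i l) <= fnat x by apply: mpair_gel.
  have Hx2 := mpair_ger A (mpair i l) (mpair b (mpair (mpair (p *' (j +' n1)) (m *' (j +' n1))) (d *' (j +' n2)))).
  rewrite -/x in Hx2.
  have Hx3 := mpair_ger A b (mpair (mpair (p *' (j +' n1)) (m *' (j +' n1))) (d *' (j +' n2))).
  have Hx4 := mpair_gel A (mpair (p *' (j +' n1)) (m *' (j +' n1))) (d *' (j +' n2)).
  have Hmul y z : fnat y <= fnat (y *' (z +' n1)).
    by rewrite !fnatE; have := fnat_ge0 A y; have := fnat_ge0 A z; nra.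
  exists i; split; first by apply/fnat_leS; apply: le_trans (mpair_gel A i l) Hx1.
  exists l; split; first by apply/fnat_leS; apply: le_trans (mpair_ger A i l) Hx1.
  exists b; split; first by apply/fnat_leS; apply: le_trans (mpair_gel A b _) Hx2.
  exists (p *' (j +' n1)); split.
    apply/fnat_leS; apply: le_trans (mpair_gel A _ (m *' (j +' n1))) _; lra.
  exists (m *' (j +' n1)); split.
    apply/fnat_leS; apply: le_trans (mpair_ger A (p *' (j +' n1)) _) _; lra.
  exists (d *' (j +' n2)); split.
    apply/fnat_leS; apply: le_trans
      (mpair_ger A (mpair (p *' (j +' n1)) (m *' (j +' n1))) _) _; lra.
  split=> //.
  exists n; split; first exact/fnat_leS.
  exists k; split; first exact/fnat_leS.
  exists j; split; first exact/fnat_leS.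
  split=> //.
  exists p; split; first exact/fnat_leS.
  exists m; split; first exact/fnat_leS.
  exists d; split=> //; apply/fnat_leS.
  have -> : j +' n2 = (j +' n1) +' n1 by nring.
  exact: Hmul.
Qed.

(** An instance of [Sigma01] collection over all indices below [m], which will bound the finite
    subcovering. Component 0 is enough for a [V] whose open sets repeat a single ball. *)
Lemma collection V : (forall i, exists b q, mballAt A V i n0 b q) ->
  forall m, exists R, forall i, i <' m ->
    exists b q, fnat (mden A q) <= fnat R /\ mballAt A V i n0 b q.
Proof.
  move=> H m.
  pose P m := exists R, forall i, i <' m -> exists b, b <' R /\ exists p, p <' R /\
    exists u, u <' R /\ exists d, d <' R /\
    mpair (mpair i n0) (mpair b (mpair (mpair p u) d)) ∈ V.
  suff [R HR] : P m.
    exists R => i /HR [b [_ [p [_ [u [_ [d [/fnat_lt/ltW Hd HV]]]]]]]].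
    by exists b, (MQ p u d).
  refine (sigma_ind A HM (fun R => ∀< i to nv 0, ∃< b to R, ∃< p to R, ∃< u to R,
      ∃< d to R, pair (pair i 0) (pair b (pair (pair p u) d)) ∈ sv 0)%fe
    env (scons V senv) _ (_ : P n0) (_ : forall m, P m -> P (m +' n1)) m).
  - solve_bounded.
  - by exists n0 => i /(mlt0 A senv HM).
  - move=> n [R HR]; have [b [[p u d] HV]] := H n.
    exists (R +' b +' p +' u +' d +' n1) => i.
    have := fnat_ge0 A R; have := fnat_ge0 A b; have := fnat_ge0 A p.
    have := fnat_ge0 A u; have := fnat_ge0 A d => ? ? ? ? ?.
    have Hlt x : x <' R -> x <' R +' b +' p +' u +' d +' n1.
      by move/fnat_lt => Hx; apply/fnat_leS; rewrite !fnatD; lra.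
    move=> /(mltS A senv HM) [/HR|->].
      move=> [b' [/Hlt Hb [p' [/Hlt Hp [u' [/Hlt Hu [d' [/Hlt Hd HV']]]]]]]].
      exists b'; split=> //; exists p'; split=> //; exists u'; split=> //.
      by exists d'.
    exists b; split; first by apply/fnat_leS; rewrite !fnatD; lra.
    exists p; split; first by apply/fnat_leS; rewrite !fnatD; lra.
    exists u; split; first by apply/fnat_leS; rewrite !fnatD; lra.
    by exists d; split; first by apply/fnat_leS; rewrite !fnatD; lra.
Qed.

Lemma constant_real q : valid q -> exists R, graph_of A (mrset A R) (fun _ => q).
Proof.
  move=> Hq; have [R HR] : exists R, forall x, x ∈ R <->
      exists k, k <' x +' n1 /\ x = mpair k (mcode A q).
    refine (bounded_comprehension A HM (∃< k to nv 0 + 1, nv 0 ≐ pair k (nv 1))%fe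
      (scons (mcode A q) env) senv _); solve_bounded.
  exists R => k; split=> // r Hr; rewrite /mrset HR; split.
    by move=> [k' [_ /mpair_inj [_ /mcode_inj]]].
  by move=> ->; exists k; split=> //; apply/fnat_leS/mpair_gel.
Qed.

Lemma constant_isReal x q : graph_of A x (fun _ => q) -> mIsReal A x.
Proof.
  move=> H; have Hq : valid q by have [] := H n0.
  split; [|split].
  - move=> k; apply/mexQP; exists q => //; exact/(graph_eq A H).
  - move=> k; apply/mallQP => r Hr; apply/mallQP => s Hs.
    by move=> /(graph_eq A H Hr) -> /(graph_eq A H Hs) ->.
  - move=> k i y; apply/mallQP => r Hr; apply/mallQP => s Hs.
    move=> /(graph_eq A H Hr) -> /(graph_eq A H Hs) -> /mpow2P ->.
    have He := exp2_valid A n1 n0 k; have := eps_gt0 A k.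
    have Hqe := mqadd_valid A _ _ Hq He.
    by split; apply/(mqleP A) => //; rewrite mqaddE // fval_eps fnatE; lra.
Qed.

Theorem HeineBorel_Lebesgue S D :
  mIsSpace A S D -> mIsHeineBorelCompact A S D -> mIsLebesgue A S D.
Proof.
  move=> HS HB U [[U1 [U2 U3]] HU].
  have U3' n k a q : valid q -> mballAt A U n k a q -> a ∈ S /\ 0 < fval q.
    move=> Hq; have /mallQP /(_ _ Hq) H := U3 n k a; move=> /H [Ha].
    have Hz : valid (mqzero A) by apply/fnat_gt0; rewrite fnatE.
    by rewrite mqltP // {1}/mqval /= !fnatE subrr mul0r.
  have [V HV] := shrunk_balls U.
  have V1 i l : exists a, exists2 q, valid q & mballAt A V i l a q.
    have [n [k [j Hdec]]] := decode_total i.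
    have [a /mexQP [q Hq Ha]] := U1 n k.
    exists a, (shrink q j); first exact: shrink_valid.
    by apply/HV; exists n, k, j; split=> //; exists q.
  (* Here [l] and [l'] may differ; this later carries the bound obtained for component 0 over to any
     component. *)
  have V2 i l l' a b q r : mballAt A V i l a q -> mballAt A V i l' b r ->
      a = b /\ q = r.
    move=> /HV [n [k [j [Hdec [q0 Hq0 [Ha ->]]]]]].
    move=> /HV [n' [k' [j' [Hdec' [r0 Hr0 [Hb ->]]]]]].
    have [En Ek Ej] := decode_unique _ _ _ _ _ _ _ Hdec Hdec'; subst n' k' j'.
    have /mallQP /(_ _ Hq0) /mallQP /(_ _ Hr0 Ha Hb) := U2 n k a b.
    by move=> [-> /mcode_inj ->].
  have Vopen : mIsOpenSeq A S V.
    split; [|split].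
    - by move=> i l; have [a [q Hq Ha]] := V1 i l; exists a; apply/mexQP; exists q.
    - move=> i l a b; apply/mallQP => q _; apply/mallQP => r _ Ha Hb.
      by have [-> ->] := V2 _ _ _ _ _ _ _ Ha Hb.
    - move=> i l a; apply/mallQP => q Hq /HV [n [k [j [_ [q0 Hq0 [Ha Eq]]]]]].
      have [HaS Hpos] := U3' _ _ _ _ Hq0 Ha; split=> //.
      have Hz : valid (mqzero A) by apply/fnat_gt0; rewrite fnatE.
      rewrite mqltP // {1}/mqval /= !fnatE subrr mul0r Eq shrinkE // subr_gt0.
      rewrite ltr_pdivrMr; have := fnat_ge0 A j; last by lra.
      by move=> Hj; have : 0 <= fval q0 * fnat j; [apply: mulr_ge0; lra|lra].
  have [|F [[m Hm] HF]] := HB V.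
    split=> // X HX; have [n [k [a /mexQP [q Hq [Ha Hball]]]]] := HU X HX.
    have [HaS Hpos] := U3' _ _ _ _ Hq Ha.
    have [f Hf] := isPoint_point_of A S D _ HX.
    move/(inBallE A S D HS _ _ _ _ _ _ (graph_mrrat A _ Hq) (point_const A S _ HaS) Hf): Hball => [l Hl].
    set t := _ + _ in Hl.
    (* The ball leaves the slack [fval q - t]; this [j] makes the loss [fval q / (j + 2)] smaller,
       so the index [l] also witnesses membership in the shrunk ball. *)
    have [j Hj] := fnat_archimedean A (fval q / (fval q - t)).
    exists (mpair (mpair n k) j), n0, a; apply/mexQP; exists (shrink q j).
      exact: shrink_valid.
    split; first by apply/HV; exists n, k, j; split=> //; exists q.
    apply/(inBallE A S D HS _ _ _ _ _ _
      (graph_mrrat A _ (shrink_valid _ _ Hq)) (point_const A S _ HaS) Hf).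
    exists l; rewrite -/t shrinkE //.
    have Hj0 := fnat_ge0 A j.
    have : fval q / (fnat j + 2) < fval q - t.
      rewrite ltr_pdivrMr; last by lra.
      move: Hj; rewrite ler_pdivrMr; last by lra.
      have : 0 < fval q - t by lra.
      by nra.
    by lra.
  have [|R HR] := collection V _ m.
    by move=> i; have [a [q _ Ha]] := V1 i n0; exists a, q.
  (* The successor keeps the denominator positive even if [R] is 0. *)
  pose r := MQ n1 n0 (R +' n1).
  have HR0 := fnat_ge0 A R.
  have Hr : valid r by apply/fnat_gt0; rewrite fnatD fnat1E; lra.
  have [Z HZ] := constant_real r Hr.
  exists Z; split; [|split].
  - exact: constant_isReal HZ.
  - have Hz : valid (mqzero A) by apply/fnat_gt0; rewrite fnatE.
    apply/(mrltP A _ _ _ _ (graph_mrrat A _ Hz) HZ).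
    have Hr0 : 0 < fval r.
      by rewrite /mqval /r /= !fnatE subr0 divr_gt0 //; lra.
    have [|k Hk] := eps_small A (fval r / 2) n0; first by lra.
    exists (n0 +' k); rewrite {1}/mqval /= !fnatE subrr mul0r; lra.
  - move=> X HX; have [i [HiF [l [b /mexQP [q Hq [HbV Hball]]]]]] := HF X HX.
    have Him := Hm i HiF.
    have /HV [n [k [j [_ [q0 Hq0 [Hb Eq]]]]]] := HbV.
    have [HbS Hpos] := U3' _ _ _ _ Hq0 Hb.
    (* The gap [q0 / (j + 2)] is at least the reciprocal of the denominator of [q], and that
       denominator is at most [R]. *)
    have Hgap : fval q + fval r <= fval q0.
      have [b' [q' [+ Hq']]] := HR i Him.
      have [_ <-] := V2 _ _ _ _ _ _ _ HbV Hq'; rewrite Eq shrinkE // => HqR.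
      have Hd : 0 < fnat (mden A q0) by apply/fnat_gt0.
      have Hnum : 1 <= fnat (mpos A q0) - fnat (mneg A q0).
        move: Hpos; rewrite /mqval pmulr_lgt0 ?invr_gt0 // subr_gt0 fnat_ltE; lra.
      have Hj := fnat_ge0 A j.
      have HT : 0 < fnat (mden A q0) * (fnat j + 2) by apply: mulr_gt0; lra.
      suff : fval r <= fval q0 / (fnat j + 2) by lra.
      rewrite {2}/mqval -mulrA -invfM ler_pdivlMr // /mqval /= !fnatE subr0 mul1r.
      rewrite mulrC ler_pdivrMr; last by lra.
      move: HqR; rewrite /= !fnatE -[1 + 1]/2 => HqR.
      apply: le_trans HqR _; nra.
    have [f Hf] := isPoint_point_of A S D _ HX.
    move/(inBall_const A S D HS _ _ _ _ Hq HbS HX Hf): Hball => [k1 [t1 Ht1 H1]].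
    exists n => Y HY HXY; have [g Hg] := isPoint_point_of A S D _ HY.
    have [k2 [t2 Ht2 H2]] := inBall_points A S D HS _ _ _ _ _ _ HZ HX Hf HY Hg HXY.
    exists k, b; apply/mexQP; exists q0 => //; split=> //.
    apply/(inBall_const A S D HS _ _ _ _ Hq0 HbS HY Hg).
    (* Past [k1 + k2] both tail bounds hold, and [t1 + t2] is below [fval q + fval r], hence below
       [fval q0]. *)
    exists (k1 +' k2), (t1 + t2); first by lra.
    move=> u; have E1 : k1 +' k2 +' u = k1 +' (k2 +' u) by nring.
    have E2 : k1 +' k2 +' u = k2 +' (k1 +' u) by nring.
    have [Hgu _] := Hg (k1 +' k2 +' u); have [Hfu _] := Hf (k1 +' k2 +' u).
    apply: (dle_trans A S D HS _ _ (f (k1 +' k2 +' u))) => //.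
      by rewrite E1.
    by rewrite E2.
Qed.

End HeineBorel.

Theorem lemma5p3 :
  proves RCA0
    (sentence (∀² A D,
       isSpace A D ⇒ isHeineBorelCompact A D ⇒ isLebesgue A D)).
Proof.
  apply completeness => M HM s r; apply (nsat_sat M _ true).
  rewrite nsat_lebesgue => S D.
  exact: (HeineBorel_Lebesgue (RcaModel M r HM)).
Qed.
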